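(* Suppose $\gamma>0.5$ and $L>0$. There exists $c>0$ depending only on $L$ and $\gamma$ such that, for any integer $D\ge1$, $$\inf_{\widehat M\in\mathbb R[A]^{n\times n}_{\le D}}\ \sup_{f\in\mathcal F_\gamma(L)}\ \sup_{\mathbb P_\xi}\ \mathbb E\big(\ell(\widehat M,M_f)\big)\ \ge\ c\,n^{-\frac{2\gamma+1}{2\gamma+2}}/D^4,$$ where $\sup_{\mathbb P_\xi}$ is over all probability distributions on $[0,1]$.
   Context: Graphon model: $\xi_1,\dots,\xi_n$ are i.i.d. from a distribution $\mathbb P_\xi$ on $[0,1]$; $f:[0,1]^2\to[0,1]$ is symmetric; $(M_f)_{ij}=f(\xi_i,\xi_j)$ for $i\ne j$ and $(M_f)_{ii}=0$. Conditionally on $(\xi_i)$, one observes a symmetric $A\in\{0,1\}^{n\times n}$ with $A_{ii}=0$ and $A_{ij}=A_{ji}\sim\mathrm{Bernoulli}((M_f)_{ij})$ independent over $1\le i<j\le n$. The expectation is over $\xi$ and $A$. The loss is $\ell(\widehat M,M_f)=\binom n2^{-1}\sum_{1\le i<j\le n}(\widehat M_{ij}-(M_f)_{ij})^2$. The notation $\widehat M\in\mathbb R[A]^{n\times n}_{\le D}$ means every entry $\widehat M_{ij}$ is a real polynomial of degree at most $D$ in the entries of $A$. Hölder class: let $\mathcal D=\{(x,y)\in[0,1]^2:x\ge y\}$, $\nabla_{jk}f=\frac{\partial^{j+k}}{(\partial x)^j(\partial y)^k}f$ with $\nabla_{00}f=f$, and $$\|f\|_{\mathcal H_\gamma}=\max_{j+k\le\lfloor\gamma\rfloor}\sup_{(x,y)\in\mathcal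 D}|\nabla_{jk}f(x,y)|+\max_{j+k=\lfloor\gamma\rfloor}\sup_{(x,y)\ne(x',y')\in\mathcal D}\frac{|\nabla_{jk}f(x,y)-\nabla_{jk}f(x',y')|}{(|x-x'|+|y-y'|)^{\gamma-\lfloor\gamma\rfloor}}.$$ $\mathcal H_\gamma(L)=\{f:\|f\|_{\mathcal H_\gamma}\le L,\ f(x,y)=f(y,x)\text{ for }x\ge y\}$ and $\mathcal F_\gamma(L)=\{f\in\mathcal H_\gamma(L):0\le f\le1\}$. *)

(* Defs.v *)
From HB Require Import structures.
From mathcomp Require Import all_boot all_order all_algebra.
From mathcomp Require Import all_classical all_reals all_analysis.
(* Not imported: the notations of mpoly clash with those of MathComp-Analysis. *)
From mathcomp Require mpoly.

Set Implicit Arguments.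
Unset Strict Implicit.
Unset Printing Implicit Defensive.

Import Order.TTheory GRing.Theory Num.Theory.
Import numFieldNormedType.Exports.

Local Open Scope classical_set_scope.
Local Open Scope ring_scope.

Definition triangle (R : realType) : set (R * R) :=
  [set p | [/\ 0 <= p.2, p.2 <= p.1 & p.1 <= 1]].

(* The difference quotients only involve points of the closed triangle, hence
   one-sided derivatives on the sides. The condition is vacuous exactly at
   (1, 1), where the horizontal slice of the triangle is a single point. *)
Definition is_dx (R : realType) (g g' : R -> R -> R) :=
  forall x y, triangle (x, y) ->
    (g t y - g x y) / (t - x)
      @[t --> within [set t | triangle (t, y)] x^'] --> g' x y.

(* Likewise, vacuous exactly at (0, 0). *)
Definition is_dy (R : realType) (g g' : R -> R -> R) :=
  forall x y, triangle (x, y) ->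
    (g x t - g x y) / (t - y)
      @[t --> within [set t | triangle (x, t)] y^'] --> g' x y.

(* [g j k] is the partial derivative of [f] on the triangle, of order [j] in x
   and [k] in y, for j + k <= m; the order of differentiation is immaterial. *)
Definition partial_derivatives (R : realType) (m : nat) (f : R -> R -> R)
    (g : nat -> nat -> R -> R -> R) :=
  [/\ forall x y, triangle (x, y) -> g 0 0 x y = f x y,
      forall j k, (j + k < m)%N -> is_dx (g j k) (g j.+1 k)
    & forall j k, (j + k < m)%N -> is_dy (g j k) (g j k.+1)].

(* The norm of f, computed from its family g of partial derivatives. *)
Definition holder_norm (R : realType) (gamma : R)
    (g : nat -> nat -> R -> R -> R) : \bar R :=
  let m := Num.truncn gamma in
  (\big[maxe/0]_(jk : 'I_m.+1 * 'I_m.+1 | (jk.1 + jk.2 <= m)%N)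
     ereal_sup [set `|g jk.1 jk.2 p.1 p.2|%:E | p in @triangle R]
   + \big[maxe/0]_(jk : 'I_m.+1 * 'I_m.+1 | (jk.1 + jk.2 == m)%N)
     ereal_sup
       [set (`|g jk.1 jk.2 pq.1.1 pq.1.2 - g jk.1 jk.2 pq.2.1 pq.2.2|
             / (`|pq.1.1 - pq.2.1| + `|pq.1.2 - pq.2.2|)
                 `^ (gamma - m%:R))%:E
       | pq in [set pq : (R * R) * (R * R) |
                 [/\ triangle pq.1, triangle pq.2 & pq.1 <> pq.2]]])%E.

(* Only the values of [f] on the unit square matter. *)
Definition holder_ball (R : realType) (gamma L : R) : set (R -> R -> R) :=
  [set f | (exists2 g, partial_derivatives (Num.truncn gamma) f g
                     & (holder_norm gamma g <= L%:E)%E)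
         /\ (forall x y, triangle (x, y) -> f x y = f y x)].

Definition holder_graphons (R : realType) (gamma L : R) : set (R -> R -> R) :=
  [set f | holder_ball gamma L f /\
    forall x y, 0 <= x <= 1 -> 0 <= y <= 1 -> 0 <= f x y <= 1].

Definition edge_probabilities (R : realType) (n : nat) (f : R -> R -> R)
    (xi : n.-tuple R) : 'M[R]_n :=
  \matrix_(i, j) if i == j then 0 else f (tnth xi i) (tnth xi j).

Definition is_adjacency (n : nat) (a : 'M[bool]_n) : bool :=
  (a^T == a) && [forall i, ~~ a i i].

(* Law of a random graph with independent edges, {i, j} being an edge with
   probability [Q i j]. *)
Definition graph_pmf (R : realType) (n : nat) (Q : 'M[R]_n) (a : 'M[bool]_n)
    : R :=
  if is_adjacency a then
    \prod_(ij : 'I_n * 'I_n | (ij.1 < ij.2)%N)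
      bernoulli_pmf (Q ij.1 ij.2) (a ij.1 ij.2)
  else 0.

(* One polynomial per entry, in n * n indeterminates; the entry (i, j) of the
   adjacency matrix is substituted for the one of index [mxvec_index i j]. *)
Definition poly_estimator (R : realType) (n : nat) :=
  'M[mpoly.mpoly (n * n) R]_n.

Definition poly_estimators_le (R : realType) (n D : nat)
    : set (poly_estimator R n) :=
  [set Mhat : poly_estimator R n | forall i j m,
     mpoly.mcoeff m (Mhat i j) != 0 -> (mpoly.mdeg m <= D)%N].

Definition estimate (R : realType) (n : nat) (Mhat : poly_estimator R n)
    (a : 'M[bool]_n) : 'M[R]_n :=
  map_mx (mpoly.meval (mxvec (map_mx (fun b : bool => b%:R) a) 0)) Mhat.

Definition loss (R : realType) (n : nat) (M M' : 'M[R]_n) : R :=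
  ('C(n, 2)%:R)^-1 *
  \sum_(ij : 'I_n * 'I_n | (ij.1 < ij.2)%N) (M ij.1 ij.2 - M' ij.1 ij.2) ^+ 2.

Definition tuple_cons d (T : measurableType d) (n : nat) (p : T * n.-tuple T)
    : n.+1.-tuple T := [tuple of p.1 :: p.2].

Lemma measurable_tuple_cons d (T : measurableType d) (n : nat) :
  measurable_fun setT (@tuple_cons d T n).
Proof. exact: measurable_cons measurable_fst measurable_snd. Qed.

HB.instance Definition _ d (T : measurableType d) (n : nat) :=
  isMeasurableFun.Build _ _ _ _ (@tuple_cons d T n)
    (@measurable_tuple_cons d T n).

(* Law of n independent random variables with law P. *)
Fixpoint iid_law d (T : measurableType d) (R : realType)
    (P : probability T R) (n : nat) : probability (n.-tuple T) R :=
  match n with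
  | 0 => dirac [tuple]
  | n'.+1 => distribution (P \x iid_law P n')%E (@tuple_cons d T n')
  end.

Definition unit_interval_laws (R : realType)
    : set (probability (measurableTypeR R) R) :=
  [set P : probability (measurableTypeR R) R | P `[0, 1]%classic = 1%E].

Definition risk (R : realType) (n : nat) (Mhat : poly_estimator R n)
    (f : R -> R -> R) (P : probability (measurableTypeR R) R) : \bar R :=
  \int[iid_law P n]_(xi in [set xi | forall i, 0 <= tnth xi i <= 1])
    (let Mf := edge_probabilities f xi in
     \sum_(a : 'M[bool]_n) graph_pmf Mf a * loss (estimate Mhat a) Mf)%:E.

(* Main.v *)
(* A single graphon suffices: the bump f(x, y) = q0 + d (1 - kappa |x -
   y|)_+^(m+1), with P uniform on the kappa points a / kappa, makes the edge
   probabilities q0 + d 1(z_i = z_j), where the labels z_i are independent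
   and uniform on kappa classes. Smoothness allows d of order
   kappa^(-gamma); we take kappa of order n^(1/(2 gamma + 2)) and d of order
   kappa^(-gamma) / D^2, and show that low-degree polynomials barely
   correlate with 1(z_i = z_j), so that the risk is at least d^2 / (2
   kappa).

   Write a polynomial of degree at most D in the edges as p(A) = sum_T
   G_T(Q) prod_(e in T) (A_e - Q_e), where Q is the matrix of edge
   probabilities and G_T = d_T p vanishes for |T| > D. Given the labels the
   products are orthogonal, so E p(A)^2 >= sum_T tau^|T| E G_T(Q)^2, while
   E[1(z_i = z_j) p(A)] = E[1(z_i = z_j) G_0(Q)].

   To bound the latter, explore the graph from i: resampling the label of
   one vertex v replaces E[phi G_T] by the sum over sets J of edges at v of
   E[phi_J G_(T u J)], where phi_J averages phi times the product over J of
   the jumps of Q. Such a product costs a factor d for each edge that ends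
   at a visited vertex and 2 d / kappa for each edge that ends at a new one.
   Since |T| <= D, at most D + 1 vertices are resampled, and when D^2 n d^2
   / kappa^2 and D^3 d^2 are small the weighted Cauchy-Schwarz inequality at
   each step loses only a bounded factor in total. This gives (E[1(z_i =
   z_j) p(A)])^2 <= e kappa^(-2) E p(A)^2, much less than P(z_i = z_j) E
   p(A)^2 = E p(A)^2 / kappa. *)
From HB Require Import structures.
Require Import Defs.
From mathcomp Require Import all_boot all_order all_algebra.
From mathcomp Require Import all_classical all_reals all_analysis.
From mathcomp Require Import measurable_realfun.
From mathcomp Require mpoly.
From mathcomp Require Import ring lra zify.

Set Implicit Arguments.
Unset Strict Implicit.
Unset Printing Implicit Defensive.

Import Order.TTheory GRing.Theory Num.Theory.
Import numFieldNormedType.Exports.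

Local Open Scope ring_scope.

(** * Multilinear polynomials and uniform labellings *)

Lemma prodrD_subsets (R : comPzRingType) (I : finType) (A : {set I})
    (F G : I -> R) :
  \prod_(i in A) (F i + G i) =
  \sum_(J : {set I} | J \subset A) \prod_(i in J) F i * \prod_(i in A :\: J) G i.
Proof.
rewrite big_mkcond /=.
rewrite (eq_bigr (fun i => (if i \in A then F i else 0)
  + (if i \in A then G i else 1))); last first.
  by move=> i _; case: ifP => // _; rewrite add0r.
rewrite bigA_distr [RHS]big_mkcond /=; apply: eq_bigr => J _.
case: ifPn => [/fintype.subsetP JA|/fintype.subsetPn[i iJ iA]]; last first.
  by rewrite (bigD1 i)//= iJ (negbTE iA) mul0r.
rewrite (big_mkcond (fun i => i \in J)) (big_mkcond (fun i => i \in A :\: J)).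
rewrite -big_split; apply: eq_bigr => i _ /=; rewrite !inE.
by case: ifPn => [/JA ->|_]; rewrite ?mulr1 ?mul1r.
Qed.

(** Cauchy-Schwarz without square roots: after symmetrizing the double sum, [a i * a j] is compared
    with the mean of [u i * s j] and [u j * s i], whose product bounds its square. *)
Lemma sqr_sum_le (R : realFieldType) (I : finType) (P : pred I)
    (a u s : I -> R) :
  (forall i, P i -> 0 <= u i) -> (forall i, P i -> 0 <= s i) ->
  (forall i, P i -> a i ^+ 2 <= u i * s i) ->
  (\sum_(i | P i) a i) ^+ 2 <= (\sum_(i | P i) u i) * (\sum_(i | P i) s i).
Proof.
move=> u0 s0 h.
rewrite expr2 !big_distrlr /=.
have sym : \sum_(i | P i) \sum_(j | P j) u i * s j =
  \sum_(i | P i) \sum_(j | P j) (u i * s j + u j * s i) / 2.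
  transitivity ((\sum_(i | P i) \sum_(j | P j) u i * s j
    + \sum_(i | P i) \sum_(j | P j) u j * s i) / 2).
    rewrite [X in (_ + X) / _]exchange_big /=; lra.
  rewrite -big_split /= mulr_suml; apply: eq_bigr => i _.
  by rewrite -big_split /= mulr_suml.
rewrite sym; apply: ler_sum => i Pi; apply: ler_sum => j Pj.
apply: (le_trans (ler_norm _)).
rewrite -[leRHS]ger0_norm; last first.
  by rewrite divr_ge0// addr_ge0// mulr_ge0// ?u0// s0.
rewrite -ler_sqr ?nnegrE// !real_normK ?num_real// exprMn.
apply: (@le_trans _ _ ((u i * s i) * (u j * s j))).
  by apply: ler_pM; rewrite ?sqr_ge0// h.
have : 0 <= (u i * s j - u j * s i) ^+ 2 by exact: sqr_ge0.
rewrite !expr2; lra.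
Qed.

Section Derivatives.
Variables (R : comPzRingType) (E : finType) (phat : {set E} -> R).

(* The partial derivative along the variables in T of the multilinear polynomial
   with coefficients phat. *)
Definition derivm (T : {set E}) (q : E -> R) : R :=
  \sum_(S : {set E} | T \subset S) phat S * \prod_(e in S :\: T) q e.

(** Taylor's formula at [q'], exact with each variable used at most once, because a multilinear
    polynomial is affine in each variable. *)
Lemma derivm_expand (T : {set E}) (q q' : E -> R) :
  derivm T q = \sum_(J : {set E} | [disjoint J & T])
    (\prod_(e in J) (q e - q' e)) * derivm (T :|: J) q'.
Proof.
rewrite /derivm.
under [RHS]eq_bigr do rewrite big_distrr /=.
rewrite (exchange_big_dep (fun S : {set E} => T \subset S)) /=; last first.
  by move=> J S _; rewrite finset.subUset => /andP[].
apply: eq_bigr => S TS.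
under eq_bigr => e _ do rewrite -[q e](subrK (q' e)).
rewrite prodrD_subsets mulr_sumr; apply: eq_big => [J|J JS].
  by rewrite finset.subsetD finset.subUset TS andbC.
rewrite mulrCA; congr (_ * (_ * _)); apply: eq_bigl => e.
by rewrite !inE negb_or andbA [(e \notin J) && _]andbC.
Qed.

Lemma derivm_eq0 (D : nat) (T : {set E}) (q : E -> R) :
  (forall S, phat S != 0 -> (#|S| <= D)%N) -> (D < #|T|)%N -> derivm T q = 0.
Proof.
move=> hD DT; apply: big1 => S TS.
have [->|/hD SD] := eqVneq (phat S) 0; first by rewrite mul0r.
by have := leq_trans DT (leq_trans (subset_leq_card TS) SD); rewrite ltnn.
Qed.

End Derivatives.

Section Resampling.
Variables (R : realFieldType) (n k : nat).
Local Notation lab := {ffun 'I_n -> 'I_k.+1}.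
Implicit Types (z y : lab) (v : 'I_n) (c : 'I_k.+1) (W : {set 'I_n}).

Definition mean (F : lab -> R) : R := (\sum_z F z) / #|{: lab}|%:R.

Definition upd z v c : lab := [ffun u => if u == v then c else z u].

Definition glue W z y : lab := [ffun u => if u \in W then z u else y u].

Lemma card_lab_gt0 : 0 < #|{: lab}|%:R :> R.
Proof. by rewrite ltr0n; apply/card_gt0P; exists [ffun=> ord0]. Qed.

(** The map from (z, c) to ([upd z v c], [z v]) is an involution: the labellings before and after
    resampling are exchangeable. *)
Lemma sum_swap v (H : lab -> lab -> R) :
  \sum_z \sum_c H z (upd z v c) = \sum_z \sum_c H (upd z v c) z.
Proof.
rewrite !pair_big /=.
pose h (p : lab * 'I_k.+1) := (upd p.1 v p.2, p.1 v).
have hK : involutive h.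
  move=> [z c]; rewrite /h /=; congr pair; last by rewrite ffunE eqxx.
  by apply/ffunP => u; rewrite !ffunE; case: eqP => // ->.
rewrite (reindex_inj (inv_inj hK)) /=; apply: eq_bigr => -[z c] _ /=.
by have /(congr1 fst) /= -> := hK (z, c).
Qed.

Lemma sum_upd v (F : lab -> R) :
  \sum_z F z = (\sum_z \sum_c F (upd z v c)) / k.+1%:R.
Proof.
rewrite (sum_swap v (fun _ z => F z)) /=.
under [in RHS]eq_bigr do rewrite sumr_const card_ord.
by rewrite sumrMnl -[X in X / _]mulr_natr mulfK// pnatr_eq0.
Qed.

Lemma mean_upd v (F : lab -> R) :
  mean F = (k.+1%:R)^-1 * \sum_c mean (fun z => F (upd z v c)).
Proof.
by rewrite /mean (sum_upd v) exchange_big /= -!mulr_suml; ring.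
Qed.

Lemma mean_ge0 (F : lab -> R) : (forall z, 0 <= F z) -> 0 <= mean F.
Proof. by move=> F0; rewrite divr_ge0// sumr_ge0. Qed.

Lemma ler_mean (F G : lab -> R) : (forall z, F z <= G z) -> mean F <= mean G.
Proof. by move=> FG; rewrite ler_wpM2r ?invr_ge0// ler_sum. Qed.

Lemma eq_mean (F G : lab -> R) : F =1 G -> mean F = mean G.
Proof. by move=> FG; congr (_ / _); apply: eq_bigr. Qed.

Lemma mean_cst (a : R) : mean (fun=> a) = a.
Proof.
rewrite /mean sumr_const -[X in X / _]mulr_natr mulfK//.
by rewrite gt_eqF// card_lab_gt0.
Qed.

Lemma meanZ (a : R) (F : lab -> R) : mean (fun z => a * F z) = a * mean F.
Proof. by rewrite /mean -mulr_sumr mulrA. Qed.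

Lemma mean_sum (I : finType) (P : pred I) (F : I -> lab -> R) :
  mean (fun z => \sum_(i | P i) F i z) = \sum_(i | P i) mean (F i).
Proof. by rewrite /mean exchange_big /= mulr_suml. Qed.

Lemma meanD (F G : lab -> R) : mean (fun z => F z + G z) = mean F + mean G.
Proof. by rewrite /mean big_split mulrDl. Qed.

Lemma mean_sqr_le (F G : lab -> R) :
  (mean (fun z => F z * G z)) ^+ 2 <=
  mean (fun z => F z ^+ 2) * mean (fun z => G z ^+ 2).
Proof.
rewrite /mean exprMn [leRHS]mulrACA -[_^-1 * _^-1]expr2.
rewrite ler_wpM2r ?sqr_ge0//.
by apply: sqr_sum_le => z _; rewrite ?sqr_ge0// exprMn.
Qed.

End Resampling.

(** * Exploration of the graph from a vertex *)

Section Exploration.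
Variables (R : realFieldType) (n k : nat) (q0 d : R).
Hypothesis d_ge0 : 0 <= d.
Local Notation lab := {ffun 'I_n -> 'I_k.+1}.
Local Notation edge := ('I_n * 'I_n)%type.
Implicit Types (z y : lab) (v : 'I_n) (c a : 'I_k.+1) (W B : {set 'I_n}).
Implicit Types (e : edge) (J T : {set edge}) (phi : lab -> R).

(* Only the pairs e with e.1 < e.2 are edges; the others get the constant 0, which
   no label influences. *)
Definition edge_mean z e : R :=
  if (e.1 < e.2)%N then q0 + (if z e.1 == z e.2 then d else 0) else 0.

Definition incident v e := (e.1 < e.2)%N && ((e.1 == v) || (e.2 == v)).

Definition opposite v e := if e.1 == v then e.2 else e.1.

(** At an end outside [B] this is the average of [jump_bound] over the label of that end: each of
    the two indicators holds for one label out of k + 1. *)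
Definition step_weight B v e : R :=
  if incident v e then
    if opposite v e \in B then d else 2 * d / k.+1%:R
  else 0.

Definition jump_bound B v a e y : R :=
  if incident v e then
    if opposite v e \in B then d
    else d * ((y v == y (opposite v e))%:R + (a == y (opposite v e))%:R)
  else 0.

Lemma incident_ends v e : incident v e ->
  [/\ opposite v e != v, e.1 \in [set v; opposite v e],
      e.2 \in [set v; opposite v e]
    & forall z, edge_mean z e
        = q0 + (if z v == z (opposite v e) then d else 0)].
Proof.
rewrite /incident /opposite => /andP[lt12 /orP[]/eqP ve]; rewrite -ve.
  rewrite eqxx !inE !eqxx orbT /edge_mean lt12; split=> //.
  by rewrite neq_ltn lt12 orbT.
have -> : (e.1 == e.2) = false by apply/eqP => e12; rewrite e12 ltnn in lt12.
rewrite !inE !eqxx orbT; split=> //; first by rewrite neq_ltn lt12.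
by move=> z; rewrite /edge_mean lt12 eq_sym.
Qed.

Lemma incident_opposite v e : incident v e ->
  e = if (v < opposite v e)%N then (v, opposite v e) else (opposite v e, v).
Proof.
rewrite /incident /opposite; case: e => x y /= /andP[xy /orP[]/eqP E]; subst v.
  by rewrite eqxx xy.
by rewrite ifN_eqC ?neq_ltn ?xy// ltnNge ltnW.
Qed.

Lemma edge_mean_upd v c z e : ~~ incident v e ->
  edge_mean (upd z v c) e = edge_mean z e.
Proof.
rewrite /incident /edge_mean !ffunE; case: ifP => //= _.
by rewrite negb_or => /andP[/negbTE-> /negbTE->].
Qed.

Lemma step_weight_ge0 B v e : 0 <= step_weight B v e.
Proof.
rewrite /step_weight; case: ifP => // _; case: ifP => // _.
by rewrite divr_ge0// mulr_ge0.
Qed.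

Lemma jump_bound_ge0 B v a e y : 0 <= jump_bound B v a e y.
Proof.
rewrite /jump_bound; case: ifP => // _; case: ifP => // _.
by rewrite mulr_ge0// addr_ge0.
Qed.

Lemma edge_mean_jump B v a e z :
  `|edge_mean z e - edge_mean (upd z v a) e| <= jump_bound B v a e z.
Proof.
have [inc|ninc] := boolP (incident v e); last first.
  by rewrite edge_mean_upd// subrr normr0 jump_bound_ge0.
rewrite /jump_bound inc; have [ov _ _ E] := incident_ends inc.
rewrite !E !ffunE eqxx (negbTE ov).
case: (_ \in B); case: (z v == _); case: (a == _); rewrite /= ler_norml;
  apply/andP; split; rewrite ?mulr1n ?mulr0n; have := d_ge0; lra.
Qed.

(** Distinct edges at [v] have distinct opposite ends, so the labels of the ends outside [B] can be
    averaged one after another. As [g] ignores them, each average turns a [jump_bound] into a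
    [step_weight]. *)
Lemma sum_jump_bound B v a J (g : lab -> R) :
  v \in B -> (forall y, 0 <= g y) ->
  (forall y u c, u \notin B -> g (upd y u c) = g y) ->
  \sum_y g y * (\prod_(e in J) jump_bound B v a e y) <=
  (\prod_(e in J) step_weight B v e) * \sum_y g y.
Proof.
move=> vB g0 gB; have [m] := ubnP #|J|; elim: m J => // m IH J Jm.
have [->|[e eJ]] := set_0Vmem J.
  by rewrite big_set0 mul1r; apply: ler_sum => y _; rewrite big_set0 mulr1.
have {}IH := IH (J :\ e); rewrite [#|J|](cardsD1 e) eJ in Jm.
have {}IH := IH Jm.
rewrite (big_setD1 e)//= -mulrA.
under eq_bigr => y _ do rewrite (big_setD1 e)//= mulrCA.
have [inc|ninc] := boolP (incident v e); last first.
  rewrite /step_weight (negbTE ninc) mul0r big1// => y _.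
  by rewrite /jump_bound (negbTE ninc) mul0r.
have [oB|oB] := boolP (opposite v e \in B).
  rewrite /step_weight inc oB.
  rewrite (eq_bigr (fun y => d *
    (g y * \prod_(e0 in J :\ e) jump_bound B v a e0 y))); last first.
    by move=> y _; rewrite {1}/jump_bound inc oB.
  by rewrite -mulr_sumr ler_wpM2l.
have [ov _ _ _] := incident_ends inc.
set u := opposite v e in oB ov *.
have uJ c y : \prod_(e0 in J :\ e) jump_bound B v a e0 (upd y u c) =
              \prod_(e0 in J :\ e) jump_bound B v a e0 y.
  apply: eq_bigr => e0; rewrite !inE => /andP[e0e _].
  rewrite /jump_bound; case: ifP => // inc0; case: ifP => // _.
  have o0u : opposite v e0 != u.
    apply: contraNneq e0e => oo.
    by apply/eqP; rewrite (incident_opposite inc0) (incident_opposite inc) oo.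
  by rewrite !ffunE (negbTE o0u) [v == _]eq_sym (negbTE ov).
rewrite (sum_upd u) /=.
rewrite (eq_bigr (fun y => (2 * d) *
    (g y * \prod_(e0 in J :\ e) jump_bound B v a e0 y))); last first.
  move=> y _; rewrite (eq_bigr (fun c : 'I_k.+1 =>
    (d * ((y v == c)%:R + (a == c)%:R)) *
    (g y * \prod_(e0 in J :\ e) jump_bound B v a e0 y))); last first.
    move=> c _; rewrite gB// uJ; congr (_ * _).
    rewrite /jump_bound inc -/u (negbTE oB) !ffunE eqxx.
    by rewrite [v == _]eq_sym (negbTE ov).
  rewrite -mulr_suml -mulr_sumr big_split /=; congr (_ * _).
  rewrite (bigD1 (y v))//= eqxx big1 ?addr0; last first.
    by move=> c /negbTE; rewrite eq_sym => ->.
  rewrite (bigD1 a)//= eqxx big1 ?addr0; last first.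
    by move=> c /negbTE; rewrite eq_sym => ->.
  by rewrite !mulr1n; ring.
rewrite -mulr_sumr mulrAC /step_weight inc -/u (negbTE oB) ler_wpM2l//.
by rewrite divr_ge0// mulr_ge0.
Qed.

(* The absolute value is averaged over the labels outside W before any squaring:
   this is where an edge to a new vertex gains a factor 1 / k.+1, against only its
   square root in mean square. *)
Definition frozen_mean W phi z : R := mean (fun y => `|phi (glue W z y)|).

(* The function phi_J obtained from phi by resampling the label of v. *)
Definition explored v phi J z : R :=
  (\sum_c phi (upd z v c) *
     \prod_(e in J) (edge_mean (upd z v c) e - edge_mean z e)) / k.+1%:R.

Definition depends_on B phi :=
  forall z z', (forall u, u \in B -> z u = z' u) -> phi z = phi z'.

Lemma frozen_mean_ge0 W phi z : 0 <= frozen_mean W phi z.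
Proof. exact: mean_ge0. Qed.

(** The average over c in [explored] and the one over the remaining labels combine into a single
    average over the labels outside [W]: c becomes the free label of [v], and [z v] the alternative
    label in [jump_bound]. *)
Lemma frozen_mean_explored W B v phi J z :
  v \in B -> v \notin W -> W \subset B -> depends_on B phi ->
  frozen_mean (v |: W) (explored v phi J) z <=
  (\prod_(e in J) step_weight B v e) * frozen_mean W phi z.
Proof.
move=> vB vW WB phiB.
pose g y := `|phi (glue W z y)|.
pose H y := g y * \prod_(e in J) jump_bound B v (z v) e y.
have glueE y u : u \notin W -> glue W z y u = y u.
  by move=> uW; rewrite ffunE (negbTE uW).
apply: (@le_trans _ _ (mean H)); last first.
  rewrite /mean /frozen_mean mulrA ler_wpM2r ?invr_ge0//.
  apply: sum_jump_bound => // [y|y u c uB]; first by rewrite normr_ge0.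
  congr (`|_|); apply: phiB => w wB.
  rewrite !ffunE; case: ifP => // _; case: eqP => // wu.
  by rewrite -wu wB in uB.
rewrite (mean_upd v H).
rewrite -mean_sum -meanZ; apply: ler_mean => y.
rewrite /explored normrM [X in _ * X <= _]ger0_norm ?invr_ge0// mulrC ler_wpM2l ?invr_ge0//.
apply: (le_trans (ler_norm_sum _ _ _)); apply: ler_sum => c _.
have -> : upd (glue (v |: W) z y) v c = glue W z (upd y v c).
  apply/ffunP => u; rewrite !ffunE !inE; case: eqP => [->|//].
  by rewrite (negbTE vW).
have -> : glue (v |: W) z y = upd (glue W z (upd y v c)) v (z v).
  by apply/ffunP => u; rewrite !ffunE !inE; case: eqP => [->|].
rewrite normrM ler_wpM2l// normr_prod; apply: ler_prod => e _.
rewrite normr_ge0 /=; apply: (le_trans (edge_mean_jump B _ _ _ _)).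
rewrite /jump_bound; case: ifP => // _; case: ifPn => // oB.
by rewrite !glueE//; apply: contra oB; apply/fintype.subsetP.
Qed.

End Exploration.

(** * The correlation inequality for low-degree polynomials *)

Section LowDegreeCorrelation.
Variables (R : realFieldType) (n k : nat) (q0 d : R).
Hypothesis d_ge0 : 0 <= d.
Local Notation lab := {ffun 'I_n -> 'I_k.+1}.
Local Notation edge := ('I_n * 'I_n)%type.
Implicit Types (z y : lab) (v : 'I_n) (c a : 'I_k.+1) (W B : {set 'I_n}).
Implicit Types (e : edge) (J T : {set edge}) (phi : lab -> R).

Variable phat : {set edge} -> R.
Local Notation G T z := (derivm phat T (@edge_mean R n k q0 d z)).

(** [G T z] is expanded around the resampled labelling. Exchanging the two labellings then moves the
    jumps onto [phi], where they are averaged over c, and leaves the derivative at z. *)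
Lemma mean_derivm_explored v T phi :
  mean (fun z => phi z * G T z) =
  \sum_(J : {set edge} | [disjoint J & T])
     mean (fun z => explored q0 d v phi J z * G (T :|: J) z).
Proof.
rewrite -mean_sum.
pose H z z' := \sum_(J : {set edge} | [disjoint J & T])
  phi z * (\prod_(e in J) (edge_mean q0 d z e - edge_mean q0 d z' e)) *
  G (T :|: J) z'.
transitivity ((\sum_z \sum_c H z (upd z v c)) / k.+1%:R / #|{: lab}|%:R).
  rewrite /mean; congr (_ / _); rewrite mulr_suml; apply: eq_bigr => z _.
  transitivity ((\sum_(c < k.+1) phi z * G T z) / k.+1%:R).
    by rewrite sumr_const card_ord -[X in X / _]mulr_natr mulfK// pnatr_eq0.
  congr (_ / _); apply: eq_bigr => c _.
  rewrite (derivm_expand _ _ _ (edge_mean q0 d (upd z v c))) mulr_sumr.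
  by apply: eq_bigr => J _; rewrite mulrA.
rewrite sum_swap /mean; congr (_ / _); rewrite mulr_suml.
apply: eq_bigr => z _; rewrite /H exchange_big /= mulr_suml.
by apply: eq_bigr => J _; rewrite /explored -mulr_suml mulrAC.
Qed.

(** For empty [T], and [x] a lower bound on the edge variances, this bounds from below the second
    moment of the polynomial over labels and graphs. *)
Definition energy (x : R) T : R :=
  \sum_(T' : {set edge} | T \subset T')
     x ^+ #|T' :\: T| * mean (fun z => G T' z ^+ 2).

Lemma energy_ge0 x T : 0 <= x -> 0 <= energy x T.
Proof.
move=> x0; apply: sumr_ge0 => T' _; rewrite mulr_ge0 ?exprn_ge0//.
by apply: mean_ge0 => z; rewrite sqr_ge0.
Qed.

Lemma energy_ge x T : 0 <= x -> mean (fun z => G T z ^+ 2) <= energy x T.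
Proof.
move=> x0; rewrite /energy (bigD1 T)//= finset.setDv cards0 expr0 mul1r lerDl.
apply: sumr_ge0 => T' _; rewrite mulr_ge0 ?exprn_ge0//.
by apply: mean_ge0 => z; rewrite sqr_ge0.
Qed.

(** The binomial formula over the subsets J of each [T' :\: T]. A step of the exploration thus
    raises the weight from [x] to [eta + x]. *)
Lemma energyD (x eta : R) T :
  \sum_(J : {set edge} | [disjoint J & T]) eta ^+ #|J| * energy x (T :|: J) =
  energy (eta + x) T.
Proof.
rewrite /energy.
under eq_bigr do rewrite mulr_sumr.
rewrite (exchange_big_dep (fun T' : {set edge} => T \subset T')) /=; last first.
  by move=> J S _; rewrite finset.subUset => /andP[].
apply: eq_bigr => T' TT'.
have := prodrD_subsets (T' :\: T) (fun=> eta) (fun=> x).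
rewrite prodr_const => ->; rewrite mulr_suml; apply: eq_big => [J|J _].
  by rewrite finset.subsetD finset.subUset TT' andbC.
by rewrite !prodr_const finset.setDDl mulrA.
Qed.

Variables (D : nat) (eta K : R).
Hypothesis phatD : forall S, phat S != 0 -> (#|S| <= D)%N.
Hypothesis eta_gt0 : 0 < eta.
Hypothesis K_ge1 : 1 <= K.
Hypothesis K_step : forall B v, v \in B -> (#|B| <= D.+2)%N ->
  \prod_e (1 + step_weight k d B v e ^+ 2 / eta) <= K.

Lemma depends_on_explored B v phi J : v \in B ->
  (forall e, e \in J -> incident v e) -> depends_on B phi ->
  depends_on (B :|: [set opposite v e | e in J]) (explored q0 d v phi J).
Proof.
move=> vB Jinc phiB z z' zz'.
have zz'B u : u \in B -> z u = z' u by move=> uB; rewrite zz'// inE uB.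
congr (_ / _); apply: eq_bigr => c _; congr (_ * _).
  by apply: phiB => u uB; rewrite !ffunE zz'B.
apply: eq_bigr => e eJ; have [_ _ _ E] := incident_ends k q0 d (Jinc e eJ).
have zo : z (opposite v e) = z' (opposite v e).
  by apply: zz'; rewrite inE imset_f ?orbT.
by rewrite !E !ffunE zo (zz'B v).
Qed.

(* B is the set of visited vertices and W that of the resampled ones; each step
   moves one vertex of B into W. The weights (m%:R * eta) ^+ #|T' :\: T| absorb the
   number of explorations that lead to the same T'. *)
Lemma correlation_le m W B T phi :
  W \subset B -> depends_on B phi -> (#|B| <= #|T| + 2)%N ->
  (D.+2 <= #|W| + m)%N ->
  (mean (fun z => phi z * G T z)) ^+ 2 <=
  mean (fun z => frozen_mean W phi z ^+ 2) * K ^+ m * energy (m%:R * eta) T.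
Proof.
have eta_ge0 := ltW eta_gt0; have K_ge0 := le_trans ler01 K_ge1.
have N_ge0 W' phi' : 0 <= mean (fun z => frozen_mean W' phi' z ^+ 2).
  by apply: mean_ge0 => z; rewrite sqr_ge0.
(* The two ways to stop: [T'] exceeds the degree and its derivative vanishes, or [phi'] sees only
   resampled vertices, so that freezing preserves its absolute value and plain Cauchy-Schwarz
   suffices. *)
have triv m' W' T' phi' : (D < #|T'|)%N \/ depends_on W' phi' ->
    (mean (fun z => phi' z * G T' z)) ^+ 2 <=
    mean (fun z => frozen_mean W' phi' z ^+ 2) * K ^+ m'
      * energy (m'%:R * eta) T'.
  case=> [DT|phiW].
    rewrite (eq_mean (G := fun=> 0)) => [|z]; last first.
      by rewrite (derivm_eq0 _ phatD)// mulr0.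
    rewrite mean_cst expr2 mul0r; apply: mulr_ge0.
      by apply: mulr_ge0; [exact: N_ge0|exact: exprn_ge0].
    by apply: energy_ge0; apply: mulr_ge0.
  apply: (le_trans (mean_sqr_le _ _)); rewrite -mulrA.
  have <- : mean (fun z => phi' z ^+ 2)
      = mean (fun z => frozen_mean W' phi' z ^+ 2).
    apply: eq_mean => z; rewrite /frozen_mean (eq_mean (G := fun=> `|phi' z|)).
      by rewrite mean_cst real_normK// num_real.
    by move=> y; congr (`|_|); apply: phiW => u uW; rewrite ffunE uW.
  apply: ler_wpM2l; first by apply: mean_ge0 => z; exact: sqr_ge0.
  rewrite -[leLHS]mul1r; apply: ler_pM => //.
  - by apply: mean_ge0 => z; exact: sqr_ge0.
  - exact: exprn_ege1.
  - by apply: energy_ge; rewrite ?mulr_ge0.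
have depW W' B' phi' : depends_on B' phi' -> B' \subset W' -> depends_on W' phi'.
  by move=> h /fintype.subsetP BW z z' zz'; apply: h => u /BW; exact: zz'.
elim: m W B T phi => [|m IH] W B T phi WB phiB BT Wm.
  (* Here [W] has at least D + 2 elements and [B] at most [#|T| + 2], so unless [T] exceeds the
     degree every visited vertex is resampled. *)
  apply: triv; have [DT|TD] := ltnP D #|T|; [by left|right].
  suff -> : W = B by [].
  apply/eqP; rewrite eqEcard WB /= (leq_trans BT)//.
  by rewrite addn2 (leq_trans _ (leq_trans Wm _)) ?addn0.
have [DT|TD] := ltnP D #|T|; first by apply: triv; left.
have [BW|/fintype.subsetPn[v vB vW]] := boolP (B \subset W).
  by apply: triv; right; exact: (depW _ _ _ phiB BW).
set x := m%:R * eta; have x_ge0 : 0 <= x by rewrite mulr_ge0.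
set N := mean (fun z => frozen_mean W phi z ^+ 2).
have N0 : 0 <= N := N_ge0 _ _.
have P_ge0 J : 0 <= \prod_(e in J) (step_weight k d B v e ^+ 2 / eta).
  by apply: prodr_ge0 => e _; rewrite divr_ge0// sqr_ge0.
have NKP_ge0 J :
    0 <= N * K ^+ m * \prod_(e in J) (step_weight k d B v e ^+ 2 / eta).
  by apply: mulr_ge0 => //; apply: mulr_ge0 => //; apply: exprn_ge0.
have sE_ge0 J : 0 <= eta ^+ #|J| * energy x (T :|: J).
  by apply: mulr_ge0; [exact: exprn_ge0|exact: energy_ge0].
have -> : m.+1%:R * eta = eta + x by rewrite /x -natr1; ring.
rewrite (mean_derivm_explored v).
(* Cauchy-Schwarz over J, the weight [eta ^+ #|J|] being moved from the squared step weights to the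
   energies. *)
apply: (@le_trans _ _
  ((\sum_(J : {set edge} | [disjoint J & T])
      N * K ^+ m * \prod_(e in J) (step_weight k d B v e ^+ 2 / eta)) *
   (\sum_(J : {set edge} | [disjoint J & T])
      eta ^+ #|J| * energy x (T :|: J)))).
  apply: sqr_sum_le => J JT.
  - exact: NKP_ge0.
  - exact: sE_ge0.
  (* A pair that is not an edge at [v] has no jump when [v] is resampled, so a set J containing one
     contributes 0. *)
  have [/forall_inP Jinc|] := boolP [forall (e | e \in J), incident v e];
    last first.
    case/forall_inPn => e eJ ninc.
    rewrite (eq_mean (G := fun=> 0)) => [|z].
      by rewrite mean_cst expr2 mul0r; apply: mulr_ge0.
    rewrite /explored big1 ?mul0r// => c _.
    by rewrite (bigD1 e)//= edge_mean_upd// subrr mul0r mulr0.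
  have cardTJ : #|T :|: J| = (#|T| + #|J|)%N.
    by rewrite cardsU disjoint_setI0 1?disjoint_sym// cards0 subn0.
  have := IH (v |: W) (B :|: [set opposite v e | e in J]) (T :|: J)
    (explored q0 d v phi J).
  move=> /(_ _ (depends_on_explored vB Jinc phiB)) IHJ.
  apply: (le_trans (IHJ _ _ _)).
  - rewrite finset.subUset finset.sub1set inE vB/=.
    by rewrite (fintype.subset_trans WB) ?finset.subsetUl.
  - rewrite cardTJ (leq_trans (leq_card_setU _ _))//.
    by rewrite addnAC leq_add// leq_imset_card.
  - by rewrite cardsU1 vW addnAC addnC.
  rewrite -/x [leRHS]mulrA ler_wpM2r ?energy_ge0//.
  have PE : \prod_(e in J) (step_weight k d B v e ^+ 2 / eta) * eta ^+ #|J| =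
      (\prod_(e in J) step_weight k d B v e) ^+ 2.
    rewrite -prodr_const -big_split -prodrXl; apply: eq_bigr => e _ /=.
    by rewrite divfK// gt_eqF.
  rewrite -[leRHS]mulrA PE -[leRHS]mulrA [K ^+ m * _]mulrC mulrA.
  apply: ler_wpM2r; first exact: exprn_ge0.
  rewrite mulrC -meanZ; apply: ler_mean => z.
  rewrite -exprMn ler_pXn2r ?nnegrE ?frozen_mean_ge0//.
    exact: frozen_mean_explored.
  rewrite mulr_ge0 ?frozen_mean_ge0// prodr_ge0// => e _.
  exact: step_weight_ge0.
rewrite energyD -mulr_sumr -/x ler_wpM2r ?energy_ge0 ?addr_ge0//.
rewrite exprSr mulrA; apply: ler_wpM2l; first by rewrite mulr_ge0 ?exprn_ge0.
have BD : (#|B| <= D.+2)%N by rewrite (leq_trans BT)// addn2 !ltnS.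
apply: le_trans (K_step vB BD).
(* Expanded, the product is the sum over all J; those that meet [T] only increase it. *)
have -> : \prod_e (1 + step_weight k d B v e ^+ 2 / eta) =
    \sum_(J : {set edge}) \prod_(e in J) (step_weight k d B v e ^+ 2 / eta).
  transitivity (\prod_(e in [set: edge]) (step_weight k d B v e ^+ 2 / eta + 1)).
    by apply: eq_big => [e|e _]; rewrite ?inE// addrC.
  rewrite prodrD_subsets; apply: eq_big => [J|J _]; first exact: finset.subsetT.
  by rewrite [X in _ * X]big1 ?mulr1.
rewrite [leRHS](bigID (fun J : {set edge} => [disjoint J & T])) /= lerDl.
by apply: sumr_ge0 => J _.
Qed.

End LowDegreeCorrelation.

(** * Low-degree mean squared error *)

Section MeanSquaredError.
Variables (R : realType) (n k : nat) (q0 d : R).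
Hypothesis d_ge0 : 0 <= d.
Local Notation lab := {ffun 'I_n -> 'I_k.+1}.
Local Notation edge := ('I_n * 'I_n)%type.

(** An edge at [v] is determined by its opposite end, so this is at most a sum over vertices: those
    of [B] cost [d ^+ 2], the others the averaged amount. *)
Lemma sum_step_weight_le (B : {set 'I_n}) v :
  \sum_e step_weight k d B v e ^+ 2 <=
  #|B|%:R * d ^+ 2 + n%:R * (2 * d / k.+1%:R) ^+ 2.
Proof.
pose w u := if u \in B then d ^+ 2 else (2 * d / k.+1%:R) ^+ 2.
have w_ge0 u : 0 <= w u by rewrite /w; case: ifP => _; exact: sqr_ge0.
rewrite (eq_bigr (fun e => if incident v e then w (opposite v e) else 0)); last first.
  move=> e _; rewrite /step_weight /w.
  by case: ifP => _; [case: ifP|rewrite expr2 mul0r].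
rewrite -big_mkcond /= (eq_bigl (fun e => e \in finset (incident v))); last first.
  by move=> e; rewrite inE.
rewrite -(big_imset (h := opposite v) w) /=; last first.
  move=> e e'; rewrite !inE => /incident_opposite E /incident_opposite E' oo.
  by rewrite E E' oo.
apply: (@le_trans _ _ (\sum_u w u)).
  by rewrite [leRHS](bigID (mem (opposite v @: finset (incident v)))) /= lerDl sumr_ge0.
apply: (@le_trans _ _ (\sum_(u : 'I_n) ((if u \in B then d ^+ 2 else 0) +
  (2 * d / k.+1%:R) ^+ 2))).
  apply: ler_sum => u _; rewrite /w.
  by case: ifP => _; rewrite ?add0r// lerDl sqr_ge0.
rewrite big_split /= -big_mkcond sumr_const sumr_const card_ord.
by rewrite !mulr_natl.
Qed.

Lemma prod_step_weight_le (eta : R) (B : {set 'I_n}) v m : 0 < eta ->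
  (#|B| <= m)%N ->
  \prod_e (1 + step_weight k d B v e ^+ 2 / eta) <=
  expR ((m%:R * d ^+ 2 + n%:R * (2 * d / k.+1%:R) ^+ 2) / eta).
Proof.
move=> eta0 Bm.
apply: (@le_trans _ _ (\prod_e expR (step_weight k d B v e ^+ 2 / eta))).
  apply: ler_prod => e _; rewrite expR_ge1Dx andbT.
  by rewrite addr_ge0// divr_ge0 ?sqr_ge0// ltW.
rewrite -expR_sum ler_expR -mulr_suml ler_wpM2r ?invr_ge0 ?(ltW eta0)//.
apply: (le_trans (sum_step_weight_le _ _)).
by rewrite lerD2r ler_wpM2r ?sqr_ge0// ler_nat.
Qed.

Variables (phat : {set edge} -> R) (D : nat) (tau : R) (i j : 'I_n).
Hypothesis phatD : forall S, phat S != 0 -> (#|S| <= D)%N.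
Hypothesis tau_gt0 : 0 < tau.
Hypothesis ij : i != j.
Hypothesis small : D.+1%:R ^+ 2 *
  (D.+2%:R * d ^+ 2 + n%:R * (2 * d / k.+1%:R) ^+ 2) <= tau.

Local Notation G T z := (derivm phat T (@edge_mean R n k q0 d z)).
Local Notation same z := ((z i == z j)%:R : R).

Lemma mean_same (a : 'I_k.+1) :
  mean (fun y : lab => (y i == a)%:R : R) = (k.+1%:R)^-1.
Proof.
rewrite (mean_upd i) (bigD1 a)//= big1 ?addr0.
  rewrite (eq_mean (G := fun=> 1)); first by rewrite mean_cst mulr1.
  by move=> z; rewrite ffunE eqxx eqxx.
move=> c /negbTE ca; rewrite (eq_mean (G := fun=> 0)); first by rewrite mean_cst.
by move=> z; rewrite ffunE eqxx ca.
Qed.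

(** With [j] frozen, the label of [i] is uniform. The square of this average is (k + 1)^(-2),
    against (k + 1)^(-1) for the mean square of the indicator: this gap yields the lower bound. *)
Lemma frozen_mean_same (z : lab) :
  frozen_mean [set j] (fun z => same z) z = (k.+1%:R)^-1.
Proof.
rewrite -(mean_same (z j)); apply: eq_mean => y.
by rewrite !ffunE !inE eqxx (negbTE ij) normr_nat.
Qed.

Lemma mean_same_pair : mean (fun z : lab => same z) = (k.+1%:R)^-1.
Proof.
rewrite (mean_upd j) -mean_sum.
rewrite (eq_mean (G := fun=> 1)); first by rewrite mean_cst mulr1.
move=> z; rewrite (bigD1 (z i))//= big1 => [|c /negbTE ci].
  by rewrite !ffunE (negbTE ij) !eqxx addr0.
by rewrite !ffunE (negbTE ij) eqxx eq_sym ci.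
Qed.

Lemma correlation_same_le :
  (mean (fun z => same z * G finset.set0 z)) ^+ 2 <=
  (k.+1%:R)^-1 ^+ 2 * expR 1 * energy k q0 d phat tau finset.set0.
Proof.
(* From [W = [set j]], D + 1 steps reach D + 2 resampled vertices. With this [eta] their weights add
   up to [tau], and their factors multiply to the exponential of (D + 1)^2 b / tau, at most e by
   [small]. *)
pose eta := tau / D.+1%:R; pose b := D.+2%:R * d ^+ 2 + n%:R * (2 * d / k.+1%:R) ^+ 2.
have D0 : (0 : R) < D.+1%:R by rewrite ltr0n.
have eta0 : 0 < eta by rewrite divr_gt0.
have b0 : 0 <= b by rewrite addr_ge0// mulr_ge0// sqr_ge0.
have K1 : 1 <= expR (b / eta) by rewrite -expR0 ler_expR divr_ge0// ltW.
have Kstep (B : {set 'I_n}) v : v \in B -> (#|B| <= D.+2)%N ->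
    \prod_e (1 + step_weight k d B v e ^+ 2 / eta) <= expR (b / eta).
  by move=> _ /prod_step_weight_le; apply.
have ij_dep : depends_on [set i; j] (fun z : lab => same z).
  by move=> z z' zz'; rewrite !zz' ?inE ?eqxx ?orbT.
have ji : [set j] \subset [set i; j] by rewrite finset.subsetUr.
have := @correlation_le _ _ _ q0 _ d_ge0 phat D eta _ phatD eta0 K1 Kstep D.+1
  _ _ finset.set0 _ ji ij_dep.
rewrite cards2 ij cards0 cards1 /= => /(_ isT (leqnn _)) /le_trans; apply.
rewrite [_ * eta](_ : _ = tau); last by rewrite /eta mulrC divfK// gt_eqF.
apply: ler_wpM2r; first by apply: energy_ge0; exact: ltW.
rewrite (eq_mean (G := fun=> (k.+1%:R)^-1 ^+ 2)) => [|z]; last first.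
  by rewrite frozen_mean_same.
rewrite mean_cst ler_wpM2l ?sqr_ge0// -expRM_natl ler_expR.
rewrite [leLHS](_ : _ = D.+1%:R ^+ 2 * b / tau).
  by rewrite ler_pdivrMr// mul1r.
rewrite /eta; field; rewrite ?(gt_eqF tau_gt0)//.
by rewrite addrC natr1 pnatr_eq0.
Qed.

(** The mean is En - 2 d m + d^2 / (k + 1), with m the correlation with the indicator and En the
    energy. As m^2 <= beta En, completing the square in m costs at most d^2 beta. *)
Lemma mean_squared_error_ge :
  d ^+ 2 / k.+1%:R - d ^+ 2 * expR 1 / k.+1%:R ^+ 2 <=
  mean (fun z => \sum_(T : {set edge}) tau ^+ #|T| * G T z ^+ 2
                 - 2 * (d * same z) * G finset.set0 z + (d * same z) ^+ 2).
Proof.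
set m := mean (fun z : lab => same z * G finset.set0 z).
set En := energy k q0 d phat tau finset.set0.
set beta := (k.+1%:R)^-1 ^+ 2 * expR 1 : R.
have -> : mean (fun z => \sum_(T : {set edge}) tau ^+ #|T| * G T z ^+ 2
      - 2 * (d * same z) * G finset.set0 z + (d * same z) ^+ 2) =
    En - 2 * d * m + d ^+ 2 / k.+1%:R.
  rewrite -mean_same_pair -!meanZ /En /energy.
  rewrite (eq_bigl xpredT) => [|T]; last exact: finset.sub0set.
  rewrite (eq_bigr (fun T : {set edge} => mean (fun z => tau ^+ #|T| * G T z ^+ 2))); last first.
    by move=> T _; rewrite meanZ finset.setD0.
  rewrite -mean_sum -[X in _ + X + _]mulN1r -meanZ -!meanD; apply: eq_mean => z.
  rewrite exprMn (_ : same z ^+ 2 = same z); first by ring.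
  by case: eqP => _; rewrite ?expr1n ?expr0n.
have mb : m ^+ 2 <= beta * En := correlation_same_le.
have b0 : 0 < beta by rewrite mulr_gt0 ?expR_gt0// exprn_gt0// invr_gt0.
have -> : d ^+ 2 * expR 1 / k.+1%:R ^+ 2 = d ^+ 2 * beta.
  by rewrite /beta exprVn; ring.
clearbody m En beta.
have E_ge : m ^+ 2 / beta <= En by rewrite ler_pdivrMr// mulrC.
have : 0 <= (m - d * beta) ^+ 2 / beta by rewrite divr_ge0 ?sqr_ge0// ltW.
have -> : (m - d * beta) ^+ 2 / beta = m ^+ 2 / beta - 2 * d * m + d ^+ 2 * beta.
  by field; rewrite gt_eqF.
move: (m ^+ 2 / beta) (d ^+ 2 * beta) (d ^+ 2 / _) (d * m) E_ge => *; lra.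
Qed.

End MeanSquaredError.

(** * Random graphs and polynomial estimators *)

Lemma derivm_neq0 (R : comPzRingType) (E : finType) (phat : {set E} -> R)
    (T : {set E}) (q : E -> R) :
  derivm phat T q != 0 -> exists2 S : {set E}, T \subset S & phat S != 0.
Proof.
move=> dT; apply/exists_inP; apply: contraNT dT => /exists_inPn p0.
apply/eqP/big1 => S /p0; rewrite negbK => /eqP ->; exact: mul0r.
Qed.

Section RandomGraph.
Variables (R : realType) (n : nat) (Q : 'M[R]_n).
Local Notation edge := ('I_n * 'I_n)%type.
Local Notation lt e := (e.1 < e.2)%N.
Local Notation q e := (Q e.1 e.2).

(** Coding graphs by boolean functions on pairs lets a sum over graphs of a product over edges
    factor by distributivity. *)
Definition upper_to_adjacency (f : {ffun edge -> bool}) : 'M[bool]_n :=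
  \matrix_(i, j) ((i < j)%N && f (i, j) || (j < i)%N && f (j, i)).

Definition adjacency_to_upper (a : 'M[bool]_n) : {ffun edge -> bool} :=
  [ffun e : edge => lt e && a e.1 e.2].

Lemma adjacency_to_upperK a : is_adjacency a ->
  upper_to_adjacency (adjacency_to_upper a) = a.
Proof.
move=> /andP[/eqP aT /forallP a0]; apply/matrixP => i j; rewrite mxE !ffunE /=.
case: (ltngtP i j) => ij /=; first by rewrite orbF.
  by rewrite -[in RHS]aT mxE.
by move/val_inj: ij => ->; exact/esym/negbTE/a0.
Qed.

Lemma is_adjacency_upper f : is_adjacency (upper_to_adjacency f).
Proof.
apply/andP; split; last by apply/forallP => i; rewrite mxE ltnn.
by apply/eqP/matrixP => i j; rewrite !mxE orbC.
Qed.

Lemma sum_graph_pmf_prod (h : edge -> bool -> R) :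
  \sum_a graph_pmf Q a * \prod_(e : edge | lt e) h e (a e.1 e.2) =
  \prod_(e : edge | lt e) \sum_b bernoulli_pmf (q e) b * h e b.
Proof.
rewrite (bigID (@is_adjacency n)) /= [X in _ + X]big1 ?addr0; last first.
  by move=> a /negbTE na; rewrite /graph_pmf na mul0r.
rewrite (big_distr_big false) /= (reindex_onto _ _ adjacency_to_upperK) /=.
apply: eq_big => [f|f _].
  rewrite is_adjacency_upper /=; apply/eqP/pffun_onP.
    move=> fE; split=> [|e]; last by [].
    by apply/fintype.subsetP => e; rewrite -fE inE ffunE eqbF_neg negbK => /andP[].
  move=> [/fintype.subsetP fE _]; apply/ffunP => e; rewrite ffunE mxE.
  have [le|nle] /= := boolP (lt e).
    by rewrite -surjective_pairing [(e.2 < e.1)%N]ltnNge ltnW// orbF.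
  apply/esym/negbTE; apply: contra nle => fe.
  by apply: (fE e); rewrite inE fe.
rewrite /graph_pmf is_adjacency_upper -big_split; apply: eq_bigr => e /= le.
by rewrite mxE le -surjective_pairing /= [(e.2 < e.1)%N]ltnNge ltnW// orbF.
Qed.

Definition edge_char (T : {set edge}) (a : 'M[bool]_n) : R :=
  \prod_(e in T) ((a e.1 e.2)%:R - q e).

(** By independence the mean factors over edges. An edge in only one of the sets gives a centred
    factor, of mean 0; an edge in both gives its variance. *)
Lemma graph_mean_edge_charM (T T' : {set edge}) :
  (forall e, e \in T -> lt e) -> (forall e, e \in T' -> lt e) ->
  \sum_a graph_pmf Q a * (edge_char T a * edge_char T' a) =
  if T == T' then \prod_(e in T) (q e * (1 - q e)) else 0.
Proof.
move=> Tlt T'lt.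
pose h e (b : bool) : R := (if e \in T then b%:R - q e else 1) *
  (if e \in T' then b%:R - q e else 1).
have charE (S : {set edge}) a : (forall e, e \in S -> lt e) ->
    edge_char S a = \prod_(e : edge | lt e) (if e \in S then (a e.1 e.2)%:R - q e else 1).
  move=> Slt; rewrite /edge_char big_mkcond [RHS]big_mkcond; apply: eq_bigr => e _.
  by case: ifP => [/Slt ->|_]; [|case: ifP].
transitivity (\sum_a graph_pmf Q a * \prod_(e : edge | lt e) h e (a e.1 e.2)).
  by apply: eq_bigr => a _; rewrite (charE T)// (charE T')// -big_split.
rewrite (sum_graph_pmf_prod h).
have hE e : \sum_b bernoulli_pmf (q e) b * h e b =
  if (e \in T) == (e \in T') then (if e \in T then q e * (1 - q e) else 1) else 0.
  rewrite big_bool /h /bernoulli_pmf.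
  by case: (e \in T); case: (e \in T') => /=; ring.
rewrite (eq_bigr _ (fun e _ => hE e)) /=.
case: eqP => [->|/eqP TT'].
  rewrite [RHS]big_mkcond [LHS]big_mkcond; apply: eq_bigr => e _ /=.
  by rewrite eqxx; case: ifP => // eT; case: ifP => // /T'lt; rewrite eT.
have [e eTT'] : exists e, (e \in T) != (e \in T').
  apply/existsP; apply: contraNT TT'; rewrite negb_exists => /forallP TT'.
  by apply/eqP/setP => e; apply/eqP; have := TT' e; rewrite negbK.
have le : lt e.
  by move: eTT'; case: (boolP (e \in T)) => [/Tlt//|_]; case: (boolP (e \in T')) => [/T'lt|].
by rewrite (bigD1 e)//= (negbTE eTT') mul0r.
Qed.

Lemma graph_mean_sqr (g : {set edge} -> R) :
  (forall (T : {set edge}) e, g T != 0 -> e \in T -> lt e) ->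
  \sum_a graph_pmf Q a * (\sum_(T : {set edge}) g T * edge_char T a) ^+ 2 =
  \sum_(T : {set edge}) \prod_(e in T) (q e * (1 - q e)) * g T ^+ 2.
Proof.
move=> glt.
transitivity (\sum_(T : {set edge}) \sum_(T' : {set edge}) g T * g T' *
    \sum_a graph_pmf Q a * (edge_char T a * edge_char T' a)).
  under [RHS]eq_bigr => T _ do under eq_bigr => T' _ do rewrite mulr_sumr.
  under [RHS]eq_bigr => T _ do rewrite exchange_big.
  rewrite [RHS]exchange_big /=; apply: eq_bigr => a _.
  rewrite expr2 big_distrlr /= mulr_sumr; apply: eq_bigr => T _.
  by rewrite mulr_sumr; apply: eq_bigr => T' _; ring.
apply: eq_bigr => T _.
have [->|gT] := eqVneq (g T) 0.
  by rewrite expr2 !mul0r mulr0 big1// => T' _; rewrite !mul0r.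
rewrite (bigD1 T)//= [X in _ + X]big1 ?addr0.
  by rewrite graph_mean_edge_charM ?eqxx; [ring|move=> e; exact: glt..].
move=> T' /negbTE T'T; have [->|gT'] := eqVneq (g T') 0.
  by rewrite mulr0 mul0r.
by rewrite graph_mean_edge_charM ?[T == T']eq_sym ?T'T ?mulr0// => e; exact: glt.
Qed.

(** Expanded around [Q], the polynomial has its derivatives at [Q] as coefficients on the orthogonal
    family [edge_char]. Subtracting [y] changes only the constant one, and Parseval's identity
    applies. *)
Lemma graph_mean_derivm (phat : {set edge} -> R) (y : R) :
  (forall (T : {set edge}) e, phat T != 0 -> e \in T -> lt e) ->
  \sum_a graph_pmf Q a *
    (derivm phat finset.set0 (fun e => (a e.1 e.2)%:R) - y) ^+ 2 =
  \sum_(T : {set edge}) \prod_(e in T) (q e * (1 - q e)) * derivm phat T (fun e => q e) ^+ 2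
  - 2 * y * derivm phat finset.set0 (fun e => q e) + y ^+ 2.
Proof.
move=> plt.
pose g T := derivm phat T (fun e => q e) - (if T == finset.set0 then y else 0).
have gE (a : 'M[bool]_n) : derivm phat finset.set0 (fun e => (a e.1 e.2)%:R) - y =
    \sum_(T : {set edge}) g T * edge_char T a.
  rewrite (derivm_expand _ _ _ (fun e => q e)).
  rewrite (eq_bigl xpredT) => [|J]; last by rewrite finset.disjoints_subset finset.setC0 finset.subsetT.
  rewrite /g; under [RHS]eq_bigr => T _ do rewrite mulrBl.
  rewrite sumrB; congr (_ - _).
    by apply: eq_bigr => T _; rewrite finset.set0U mulrC.
  rewrite (bigD1 finset.set0)//= eqxx /edge_char big_set0 mulr1 big1 ?addr0//.
  by move=> T /negbTE ->; rewrite mul0r.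
under eq_bigr do rewrite gE.
rewrite graph_mean_sqr; last first.
  move=> T e gT eT; have T0 : T != finset.set0 by apply/set0Pn; exists e.
  have [S TS pS] : exists2 S : {set edge}, T \subset S & phat S != 0.
    apply: derivm_neq0; move: gT; rewrite /g (negbTE T0) subr0; exact.
  exact: plt pS (fintype.subsetP TS _ eT).
rewrite (bigD1 finset.set0)//= [in RHS](bigD1 finset.set0)//= !big_set0 /g eqxx.
rewrite (eq_bigr (fun T : {set edge} => \prod_(e in T) (q e * (1 - q e)) *
  derivm phat T (fun e => q e) ^+ 2)); first by ring.
by move=> T /negbTE ->; rewrite subr0.
Qed.

End RandomGraph.

(** * Reduction to multilinear polynomials *)

Lemma prodr_nat_bool (R : comPzRingType) (I : finType) (P : pred I) (b : pred I) :
  \prod_(i | P i) (b i)%:R = ([forall (i | P i), b i] : bool)%:R :> R.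
Proof.
have [/forall_inP h|/forall_inPn[i Pi bi]] := boolP [forall (i | P i), b i].
  by rewrite big1// => i /h ->.
by rewrite (bigD1 i)//= (negbTE bi) mul0r.
Qed.

Section MultilinearForm.
Variables (R : realType) (n : nat).
Local Notation edge := ('I_n * 'I_n)%type.
Local Notation lt e := (e.1 < e.2)%N.
Local Notation mon := (mpoly.multinom (n * n)).

Definition expo (m : mon) (i j : 'I_n) : nat :=
  mpoly.fun_of_multinom m (mxvec_index i j).

Definition monomial_edges (m : mon) : {set edge} :=
  [set e : edge | lt e & (0 < expo m e.1 e.2 + expo m e.2 e.1)%N].

Definition loop_free (m : mon) : bool := [forall i, expo m i i == 0%N].

Lemma big_mxvec_index (T : Type) (idx : T) (op : Monoid.com_law idx)
    (F : 'I_(n * n) -> T) :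
  \big[op/idx]_t F t = \big[op/idx]_(e : edge) F (mxvec_index e.1 e.2).
Proof.
rewrite (reindex (uncurry (@mxvec_index n n))) /=; last first.
  exact: curry_mxvec_bij.
by apply: eq_bigr => -[i j] _.
Qed.

Lemma card_monomial_edges (m : mon) : (#|monomial_edges m| <= mpoly.mdeg m)%N.
Proof.
rewrite mpoly.mdegE big_mxvec_index /=.
apply: (@leq_trans (\sum_(e : edge | lt e) (expo m e.1 e.2 + expo m e.2 e.1))).
  rewrite -sum1_card [leqLHS](eq_bigl (fun e : edge =>
    lt e && (0 < expo m e.1 e.2 + expo m e.2 e.1)%N)) => [|e]; last by rewrite inE.
  rewrite big_mkcondr; apply: leq_sum => e _.
  by case: ifP.
rewrite big_split /= [leqRHS](bigID (fun e : edge => lt e)) /= leq_add2l.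
have swapK : involutive (fun e : edge => (e.2, e.1)) by case.
rewrite [leqLHS](reindex_inj (inv_inj swapK)) /=.
rewrite [leqRHS](bigID (fun e : edge => (e.2 < e.1)%N)) /=.
apply: leq_trans (leq_addr _ _); apply: eq_leq; apply: eq_bigl => e.
by rewrite -leqNgt andb_idl// => /ltnW.
Qed.

(** The entries are 0 or 1, so the size of a positive exponent is irrelevant; symmetry merges the
    variables (i, j) and (j, i), and a diagonal variable makes the monomial vanish. *)
Lemma eval_monomial (m : mon) (a : 'M[bool]_n) : is_adjacency a ->
  \prod_t mxvec (map_mx (fun b : bool => b%:R : R) a) 0 t
    ^+ mpoly.fun_of_multinom m t =
  (loop_free m)%:R * \prod_(e in monomial_edges m) (a e.1 e.2)%:R.
Proof.
move=> /andP[/eqP aT /forallP a0]; rewrite big_mxvec_index /=.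
rewrite (eq_bigr (fun e : edge => ((expo m e.1 e.2 == 0%N) || a e.1 e.2)%:R));
  last first.
  move=> e _; rewrite mxvecE mxE -/(expo m e.1 e.2).
  by case: (expo _ _ _) => [|x]; case: (a _ _); rewrite ?expr1n ?expr0// expr0n.
rewrite !prodr_nat_bool -natrM mulnb; congr (nat_of_bool _)%:R.
apply/forall_inP/andP => [h|[/forallP m0 /forall_inP h] e _].
  split.
    by apply/forallP => i; have := h (i, i) isT; rewrite /= (negbTE (a0 i)) orbF.
  apply/forall_inP => e; rewrite inE => /andP[_].
  rewrite addn_gt0 => /orP[]; rewrite lt0n => /negbTE m0.
    by have := h (e.1, e.2) isT; rewrite /= m0.
  by have := h (e.2, e.1) isT; rewrite /= m0 -[in X in X -> _]aT mxE.
have [//|m0e] := eqVneq (expo m e.1 e.2) 0%N; rewrite /=.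
case: (ltngtP e.1 e.2) => e12.
- by apply: h; rewrite inE e12 addn_gt0 lt0n m0e.
- have := h (e.2, e.1); rewrite inE /= e12 addn_gt0 [X in _ || X]lt0n m0e orbT.
  by move=> /(_ isT); rewrite -[in X in X -> _]aT mxE.
by move/val_inj: e12 m0e => ->; rewrite (eqP (m0 _)).
Qed.

Lemma estimate_multilinear D (Mhat : poly_estimator R n) i j :
  poly_estimators_le D Mhat ->
  exists phat : {set edge} -> R,
    [/\ forall S : {set edge}, phat S != 0 -> (#|S| <= D)%N,
        forall (S : {set edge}) e, phat S != 0 -> e \in S -> lt e
      & forall a, is_adjacency a ->
          estimate Mhat a i j =
          derivm phat finset.set0 (fun e => (a e.1 e.2)%:R)].
Proof.
move=> MD; set p := Mhat i j.
(* Monomials that reduce to the same set of edges are pooled into one coefficient. *)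
pose phat (S : {set edge}) : R := \sum_(m <- mpoly.msupp p)
  (if monomial_edges m == S then mpoly.mcoeff m p * (loop_free m)%:R else 0).
have phat_neq0 S : phat S != 0 ->
    exists2 m : mon, mpoly.mcoeff m p != 0 & monomial_edges m = S.
  move=> pS; have [|no] := pselect (exists2 m : mon,
    mpoly.mcoeff m p != 0 & monomial_edges m = S); first by [].
  case/eqP: pS; apply: big1 => m _; case: eqP => // mS.
  have [->|pm] := eqVneq (mpoly.mcoeff m p) 0; first by rewrite mul0r.
  by case: no; exists m.
exists phat; split=> [S /phat_neq0[m pm <-]|S e /phat_neq0[m _ <-]|a aadj].
- exact: leq_trans (card_monomial_edges m) (MD _ _ _ pm).
- by rewrite inE => /andP[].
rewrite /estimate mxE mpoly.mevalE /derivm.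
under [RHS]eq_bigr => S _ do rewrite finset.setD0 mulr_suml.
rewrite exchange_big /=; apply: eq_bigr => m _.
rewrite eval_monomial// (bigD1 (monomial_edges m)) ?finset.sub0set//= eqxx.
rewrite [X in _ = _ + X]big1 ?addr0 ?mulrA// => S /andP[_ /negbTE Sm].
by rewrite eq_sym Sm mul0r.
Qed.

End MultilinearForm.

Local Open Scope classical_set_scope.

(** * The bump graphon *)

Section Ramp.
Variable R : realType.
Implicit Types (a b u v : R) (s : nat).

Definition pospart a : R := Num.max 0 a.

Lemma pospart_ge0 a : 0 <= pospart a.
Proof. by rewrite le_max lexx. Qed.

Lemma pospart_le1 a : a <= 1 -> pospart a <= 1.
Proof. by move=> a1; rewrite ge_max ler01. Qed.

Lemma pospart_lip a b : `|pospart a - pospart b| <= `|a - b|.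
Proof.
rewrite /pospart /Num.max; case: ltP => a0; case: ltP => b0 //.
- by rewrite subr0 gtr0_norm// (le_trans _ (ler_norm _))//; lra.
- by rewrite sub0r normrN gtr0_norm// distrC (le_trans _ (ler_norm _))//; lra.
- by rewrite subrr normr0.
Qed.

Lemma expr_taylor1 s u v : 0 <= u <= 1 -> 0 <= v <= 1 ->
  `|u ^+ s.+1 - v ^+ s.+1 - s.+1%:R * v ^+ s * (u - v)|
  <= (s * s.+1)%:R * (u - v) ^+ 2.
Proof.
move=> /andP[u0 u1] /andP[v0 v1]; elim: s => [|s IH].
  by rewrite !expr1 expr0 mulr1 mul1r subrr normr0 mul0r.
have -> : u ^+ s.+2 - v ^+ s.+2 - s.+2%:R * v ^+ s.+1 * (u - v) =
  u * (u ^+ s.+1 - v ^+ s.+1 - s.+1%:R * v ^+ s * (u - v))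
  + s.+1%:R * v ^+ s * (u - v) ^+ 2.
  by rewrite -[s.+2%:R]natr1 (exprS u s.+1) (exprS v s.+1) (exprS v s); ring.
apply: (le_trans (ler_normD _ _)).
have -> : (s.+1 * s.+2)%:R = (s * s.+1)%:R + 2 * s.+1%:R :> R.
  by rewrite -natrM -natrD; congr _%:R; lia.
rewrite mulrDl lerD//.
  by rewrite normrM (ger0_norm u0) (le_trans _ IH)// ler_piMl.
rewrite ger0_norm; last first.
  by apply: mulr_ge0; [apply: mulr_ge0 => //; exact: exprn_ge0|exact: sqr_ge0].
rewrite ler_wpM2r ?sqr_ge0// mulrC ler_wpM2r//.
have vs1 : v ^+ s <= 1 by apply: exprn_ile1.
by rewrite (le_trans vs1)// ler1n.
Qed.

(** The kink at 0 adds an error only when b > 0 >= a. Then both [pospart b], a factor available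
    because s > 0, and the error - a are at most |a - b|. *)
Lemma pospart_taylor1 s a b : (0 < s)%N -> a <= 1 -> b <= 1 ->
  `|pospart a ^+ s.+1 - pospart b ^+ s.+1
    - s.+1%:R * pospart b ^+ s * (a - b)|
  <= (s.+1 * s.+1)%:R * (a - b) ^+ 2.
Proof.
move=> s0 a1 b1.
have pa : 0 <= pospart a <= 1 by rewrite pospart_ge0 pospart_le1.
have pb : 0 <= pospart b <= 1 by rewrite pospart_ge0 pospart_le1.
have -> : pospart a ^+ s.+1 - pospart b ^+ s.+1
    - s.+1%:R * pospart b ^+ s * (a - b) =
  (pospart a ^+ s.+1 - pospart b ^+ s.+1
    - s.+1%:R * pospart b ^+ s * (pospart a - pospart b))
  + s.+1%:R * (pospart b ^+ s * ((pospart a - pospart b) - (a - b))) by ring.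
apply: (le_trans (ler_normD _ _)).
rewrite mulSn addnC natrD mulrDl lerD//.
  apply: (le_trans (expr_taylor1 _ pa pb)).
  by rewrite ler_wpM2l// -[leLHS]real_normK ?num_real// -[leRHS]real_normK ?num_real//
    ler_sqr ?nnegrE// pospart_lip.
rewrite normrM normr_nat ler_wpM2l//.
case/andP: pb => pb0 pb1.
rewrite normrM [X in X * _]ger0_norm ?exprn_ge0//.
case: s s0 => // s _; rewrite exprS -mulrA.
apply: (@le_trans _ _ (pospart b * `|pospart a - pospart b - (a - b)|)).
  by rewrite ler_wpM2l// ler_piMl// exprn_ile1.
rewrite /pospart /Num.max; case: (ltP 0 b) => b0; last by rewrite mul0r sqr_ge0.
case: ltP => a0; first by rewrite subrr normr0 mulr0 sqr_ge0.
have -> : 0 - b - (a - b) = - a by ring.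
rewrite ger0_norm ?oppr_ge0// expr2 -mulrNN; nra.
Qed.

Lemma within_dnbhs_cvg (A : set R) (x l C : R) (h : R -> R) :
  (forall t, A t -> t != x -> `|h t - l| <= C * `|t - x|) ->
  h t @[t --> within A x^'] --> l.
Proof.
move=> hC; apply/cvgrPdist_le => e e0; rewrite near_withinE.
have C0 : 0 < `|C| + 1 by rewrite ltr_wpDl.
near=> t => At.
rewrite distrC (le_trans (hC t At _))//; first by near: t; exact: nbhs_dnbhs_neq.
have : `|x - t| < e / (`|C| + 1).
  near: t; apply: nbhs_dnbhs; apply: nbhsx_ballx.
  by rewrite divr_gt0.
rewrite ltr_pdivlMr// distrC => /ltW; apply: le_trans.
rewrite mulrC ler_wpM2l// (le_trans (ler_norm C))// lerDl.
Unshelve. all: by end_near. Qed.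

End Ramp.

Section Bump.
Variables (R : realType) (m : nat) (q0 d kappa : R).
Hypotheses (q0_ge0 : 0 <= q0) (d_ge0 : 0 <= d) (kappa_ge1 : 1 <= kappa).

Local Notation w x y := (1 - kappa * (x - y)).

(** The exponent leaves one factor [pospart] in the derivatives of order m, which are therefore
    Lipschitz. *)
Definition bump_graphon (x y : R) : R :=
  q0 + d * pospart (1 - kappa * `|x - y|) ^+ m.+1.

(** These are derivatives on the triangle, where |x - y| = x - y has no kink up to the diagonal. *)
Definition bump_derivative (j l : nat) (x y : R) : R :=
  (if (j + l)%N == 0%N then q0 else 0) +
  d * ((m.+1 ^_ (j + l))%:R * ((- kappa) ^+ j * kappa ^+ l)) *
  pospart (w x y) ^+ (m.+1 - (j + l)).

Let kappa_ge0 : 0 <= kappa := le_trans ler01 kappa_ge1.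

Lemma triangle_w_le1 x y : triangle (x, y) -> w x y <= 1.
Proof.
move=> [/= y0 yx x1]; rewrite lerBlDr lerDl mulr_ge0// subr_ge0//.
Qed.

(** Serves both directions: z is the increment of the variable and C, equal to - kappa in x and
    kappa in y, is the slope of the argument of [pospart]. *)
Lemma bump_derivative_taylor1 (j l : nat) (C : R) (x y x' y' z : R) :
  (j + l < m)%N -> triangle (x, y) -> triangle (x', y') ->
  w x' y' - w x y = C * z -> `|C| <= kappa -> z != 0 ->
  `|(bump_derivative j l x' y' - bump_derivative j l x y) / z -
    d * ((m.+1 ^_ (j + l).+1)%:R * ((- kappa) ^+ j * kappa ^+ l)) *
    pospart (w x y) ^+ (m - (j + l)) * C| <=
  `|d * ((m.+1 ^_ (j + l))%:R * ((- kappa) ^+ j * kappa ^+ l))|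
   * (m.+1 * m.+1)%:R * kappa ^+ 2 * `|z|.
Proof.
move=> jlm tri tri' wC Ck z0.
set K := (- kappa) ^+ j * kappa ^+ l.
set s := (m - (j + l))%N.
have s0 : (0 < s)%N by rewrite subn_gt0.
have sE : (m.+1 - (j + l) = s.+1)%N by rewrite /s; lia.
have ffE : (m.+1 ^_ (j + l).+1)%:R = (m.+1 ^_ (j + l))%:R * s.+1%:R :> R.
  by rewrite ffactnSr natrM sE.
set F := (m.+1 ^_ (j + l))%:R in ffE *.
have := pospart_taylor1 s0 (triangle_w_le1 tri') (triangle_w_le1 tri).
rewrite wC => T.
have -> : (bump_derivative j l x' y' - bump_derivative j l x y) / z -
    d * ((m.+1 ^_ (j + l).+1)%:R * K) * pospart (w x y) ^+ s * C =
  d * (F * K) * (pospart (w x' y') ^+ s.+1 - pospart (w x y) ^+ s.+1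
    - s.+1%:R * pospart (w x y) ^+ s * (C * z)) / z.
  by rewrite /bump_derivative sE ffE -/K -/F; field.
rewrite normrM normrM normfV ler_pdivrMr ?normr_gt0//.
rewrite (_ : _ * `|z| * `|z| = `|d * (F * K)| *
  ((m.+1 * m.+1)%:R * (kappa ^+ 2 * `|z| ^+ 2))); last by ring.
rewrite ler_wpM2l// (le_trans T)//.
have sm : (s.+1 * s.+1 <= m.+1 * m.+1)%N by apply: leq_mul; rewrite ltnS leq_subr.
apply: ler_pM; rewrite ?sqr_ge0// ?ler_nat//.
rewrite exprMn real_normK ?num_real// ler_wpM2r ?sqr_ge0//.
by rewrite -[C ^+ 2]real_normK ?num_real// ler_sqr ?nnegrE.
Qed.

Lemma bump_partial_derivatives :
  partial_derivatives m bump_graphon bump_derivative.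
Proof.
split=> [x y [/= y0 yx x1]|j l jlm x y tri|j l jlm x y tri].
- rewrite /bump_derivative /bump_graphon ger0_norm ?subr_ge0// ffactn0 subn0.
  by rewrite !expr0 !mulr1.
- apply: (@within_dnbhs_cvg _ _ _ _ _) => t trit tx.
  have -> : bump_derivative j.+1 l x y =
      d * ((m.+1 ^_ (j + l).+1)%:R * ((- kappa) ^+ j * kappa ^+ l)) *
      pospart (w x y) ^+ (m - (j + l)) * (- kappa).
    by rewrite /bump_derivative addSn subSS exprS /=; ring.
  apply: (bump_derivative_taylor1 jlm tri trit); rewrite ?subr_eq0//; first by ring.
  by rewrite normrN ger0_norm.
- apply: (@within_dnbhs_cvg _ _ _ _ _) => t trit ty.
  have -> : bump_derivative j l.+1 x y =
      d * ((m.+1 ^_ (j + l).+1)%:R * ((- kappa) ^+ j * kappa ^+ l)) *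
      pospart (w x y) ^+ (m - (j + l)) * kappa.
    by rewrite /bump_derivative addnS subSS exprS /=; ring.
  apply: (bump_derivative_taylor1 jlm tri trit); rewrite ?subr_eq0//; first by ring.
  by rewrite ger0_norm.
Qed.


Lemma ffact_le_fact p : (m.+1 ^_ p <= m.+1`!)%N.
Proof.
case: (leqP p m.+1) => pm; first by rewrite -(ffact_fact pm) leq_pmulr// fact_gt0.
by rewrite ffact_small.
Qed.

Lemma bump_derivative_coef_le (j l : nat) : (j + l <= m)%N ->
  `|d * ((m.+1 ^_ (j + l))%:R * ((- kappa) ^+ j * kappa ^+ l))|
  <= d * (m.+1`!)%:R * kappa ^+ m.
Proof.
move=> jlm; rewrite !normrM !normrX normrN (ger0_norm kappa_ge0) normr_nat.
rewrite (ger0_norm d_ge0) -exprD -!mulrA ler_wpM2l//.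
by rewrite ler_pM ?exprn_ge0 ?ler_nat ?ffact_le_fact// ler_weXn2l.
Qed.

Lemma bump_derivative_le (j l : nat) (x y : R) : (j + l <= m)%N ->
  triangle (x, y) ->
  `|bump_derivative j l x y| <= q0 + d * (m.+1`!)%:R * kappa ^+ m.
Proof.
move=> jlm tri; rewrite (le_trans (ler_normD _ _))// lerD//.
  by case: ifP => _; rewrite ?normr0// ger0_norm.
rewrite normrM (le_trans _ (bump_derivative_coef_le jlm))// ler_piMr//.
rewrite ger0_norm ?exprn_ge0 ?pospart_ge0// exprn_ile1 ?pospart_ge0//.
by rewrite pospart_le1// triangle_w_le1.
Qed.

(** Derivatives of order m are affine in [pospart], whose increments are at most min(1, kappa s)
    with s the l1 distance; and min(1, t) <= t^beta for beta in [0, 1]. *)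
Lemma bump_derivative_holder (beta : R) (j l : nat) (p q : R * R) :
  0 <= beta <= 1 -> (j + l)%N = m -> triangle p -> triangle q -> p <> q ->
  `|bump_derivative j l p.1 p.2 - bump_derivative j l q.1 q.2|
    / (`|p.1 - q.1| + `|p.2 - q.2|) `^ beta
  <= d * (m.+1`!)%:R * kappa ^+ m * kappa `^ beta.
Proof.
case: p q => [x y] [x' y'] /andP[beta0 beta1] jlm tri tri' pq /=.
set s := `|x - x'| + `|y - y'|.
have s_gt0 : 0 < s.
  rewrite lt_neqAle addr_ge0// andbT eq_sym paddr_eq0// !normr_eq0 !subr_eq0.
  by apply/negP => /andP[/eqP xx /eqP yy]; apply: pq; rewrite xx yy.
rewrite ler_pdivrMr ?powR_gt0// -[leRHS]mulrA -powRM ?(ltW s_gt0)//.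
rewrite /bump_derivative jlm subSnn !expr1 opprD addrACA subrr add0r -mulrBr normrM.
apply: ler_pM => //; first by have := bump_derivative_coef_le (eq_leq jlm); rewrite jlm.
have le1 : `|pospart (w x y) - pospart (w x' y')| <= 1.
  have := pospart_le1 (triangle_w_le1 tri).
  have := pospart_le1 (triangle_w_le1 tri').
  have := pospart_ge0 (w x y); have := pospart_ge0 (w x' y').
  by rewrite ler_norml => *; apply/andP; split; lra.
have les : `|pospart (w x y) - pospart (w x' y')| <= kappa * s.
  apply: (le_trans (pospart_lip _ _)).
  have -> : w x y - w x' y' = kappa * ((y - y') - (x - x')) by ring.
  by rewrite normrM ger0_norm// ler_wpM2l// (le_trans (ler_normB _ _))// addrC.
have ks_gt0 : 0 < kappa * s by rewrite mulr_gt0// (lt_le_trans ltr01).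
have [ks1|/ltW ks1] := leP 1 (kappa * s).
  apply: (le_trans le1); rewrite -[leLHS](powRr0 (kappa * s)).
  exact: ler_powR.
apply: (le_trans les); rewrite -[leLHS]powRr1 ?(ltW ks_gt0)//.
by apply: ger_powR => //; rewrite ks_gt0.
Qed.

Lemma bump_holder_norm (gamma L : R) : m = Num.truncn gamma -> 0 <= gamma ->
  q0 + 2 * (d * (m.+1`!)%:R * kappa `^ gamma) <= L ->
  (holder_norm gamma bump_derivative <= L%:E)%E.
Proof.
move=> mE g0 hL; have /andP[mg gm] := truncn_itv g0.
rewrite /holder_norm -mE in mg gm *.
have kg : kappa ^+ m * kappa `^ (gamma - m%:R) = kappa `^ gamma.
  rewrite -powR_mulrn// -powRD ?subrKC// implybE; apply/orP; right.
  by rewrite gt_eqF// (lt_le_trans ltr01).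
have km : kappa ^+ m <= kappa `^ gamma by rewrite -powR_mulrn// ler_powR.
have A_ge0 : 0 <= d * (m.+1`!)%:R by rewrite mulr_ge0.
have bnd1 : q0 + d * (m.+1`!)%:R * kappa ^+ m
    <= q0 + d * (m.+1`!)%:R * kappa `^ gamma by rewrite lerD2l ler_wpM2l.
apply: (@le_trans _ _ ((q0 + d * (m.+1`!)%:R * kappa `^ gamma)%:E
  + (d * (m.+1`!)%:R * kappa `^ gamma)%:E)%E); last first.
  by rewrite -EFinD lee_fin; lra.
apply: leeD.
- apply: bigmax_le => [|[j l] /= jlm].
    by rewrite lee_fin addr_ge0// mulr_ge0// powR_ge0.
  apply: ge_ereal_sup => _ /= [[x y] tri <-]; rewrite lee_fin.
  by apply: le_trans bnd1; exact: bump_derivative_le.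
- apply: bigmax_le => [|[j l] /= /eqP jlm].
    by rewrite lee_fin mulr_ge0// powR_ge0.
  apply: ge_ereal_sup => _ /= [[p q] [/= trip triq pq] <-]; rewrite lee_fin.
  rewrite -kg mulrA; apply: bump_derivative_holder => //.
  by rewrite subr_ge0 mg/=; lra.
Qed.

Lemma bump_graphon_itv (x y : R) : q0 + d <= 1 -> 0 <= bump_graphon x y <= 1.
Proof.
move=> q0d; rewrite /bump_graphon.
have w1 : 1 - kappa * `|x - y| <= 1 by rewrite lerBlDr lerDl mulr_ge0.
have p0 := pospart_ge0 (1 - kappa * `|x - y|).
rewrite addr_ge0 ?mulr_ge0 ?exprn_ge0//= (le_trans _ q0d)// lerD2l ler_piMr//.
by rewrite exprn_ile1// pospart_le1.
Qed.

Lemma bump_holder_graphon (gamma L : R) : m = Num.truncn gamma -> 0 <= gamma ->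
  q0 + 2 * (d * (m.+1`!)%:R * kappa `^ gamma) <= L -> q0 + d <= 1 ->
  holder_graphons gamma L bump_graphon.
Proof.
move=> mE g0 hL q0d; split; first split.
- exists bump_derivative; last exact: bump_holder_norm.
  by rewrite -mE; exact: bump_partial_derivatives.
- by move=> x y _; rewrite /bump_graphon distrC.
by move=> x y _ _; exact: bump_graphon_itv.
Qed.

(** Distinct grid points are at least 1 / kappa apart, where the bump has vanished. *)
Lemma bump_graphon_grid (a b : nat) :
  bump_graphon (a%:R / kappa) (b%:R / kappa) =
  q0 + (if a == b then d else 0).
Proof.
have k0 : 0 < kappa by exact: lt_le_trans kappa_ge1.
rewrite /bump_graphon -mulrBl normrM normfV (ger0_norm kappa_ge0).
rewrite [kappa * _]mulrC divfK; last by rewrite gt_eqF.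
congr (_ + _).
case: eqP => [->|/eqP ab].
  by rewrite subrr normr0 subr0 /pospart max_r ?ler01// expr1n mulr1.
rewrite /pospart max_l ?expr0n ?mulr0// subr_le0.
have : (1 <= `|a%:Z - b%:Z|)%R by rewrite -gtz0_ge1 normr_gt0 subr_eq0.
by rewrite -(ler_int R) intr_norm rmorphB.
Qed.

End Bump.

(** * The uniform law on a grid *)

(** Read off the definition of the integral as a supremum over simple functions below the integrand,
    so that it applies to an arbitrary nonnegative [f]. *)
Lemma le_integral_patch d (T : measurableType d) (R : realType)
    (mu : {measure set T -> \bar R}) (D : set T) (f g : T -> \bar R) :
  (forall x, D x -> 0 <= f x)%E -> (forall x, 0 <= g x)%E ->
  (forall x, g x <= (f \_ D) x)%E ->
  (\int[mu]_x g x <= \int[mu]_(x in D) f x)%E.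
Proof.
move=> f0 g0 gf; rewrite ge0_integralTE// ge0_integralE//.
apply: ereal_sup_le => _ /= [h hg <-]; exists h => // x.
exact: le_trans (hg x) (gf x).
Qed.

Lemma measurable_set1_tuple d (T : measurableType d) (n : nat)
    (t : n.-tuple T) : (forall x : T, measurable [set x]) ->
  measurable [set t].
Proof.
move=> m1.
have -> : [set t] = \big[setI/setT]_(i < n) ((@tnth n T)^~ i @^-1` [set tnth t i]).
  apply/seteqP; split=> [_ -> |s].
    by rewrite -bigcap_seq => i _.
  by rewrite -bigcap_seq => st; apply: eq_from_tnth => i; apply: st => /=; rewrite mem_index_enum.
apply: bigsetI_measurable => i _.
by rewrite -[X in measurable X]setTI; exact: measurable_tnth.
Qed.

Lemma iid_law_set1 d (T : measurableType d) (R : realType)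
    (P : probability T R) (n : nat) (t : n.-tuple T) :
  (forall x : T, measurable [set x]) ->
  iid_law P n [set t] = (\prod_(i < n) P [set tnth t i])%E.
Proof.
move=> m1; elim: n t => [|n IH] t.
  by rewrite big_ord0 /= diracE mem_set// (tuple0 t).
rewrite big_ord_recl.
transitivity ((P \x iid_law P n)%E (@tuple_cons d T n @^-1` [set t])).
  by [].
have -> : @tuple_cons d T n @^-1` [set t] =
    [set thead t] `*` [set [tuple of behead t]].
  apply/seteqP; split=> [[x s] /= <-|[x s] [/= -> ->]].
    by split; [rewrite theadE|apply: val_inj].
  by rewrite [RHS]tuple_eta.
rewrite product_measure1E//; last exact: measurable_set1_tuple.
congr (_ * _)%E; apply: etrans (IH _) _; apply: eq_bigr => i _.
by congr (P [set _]); rewrite [in RHS](tuple_eta t) tnthS.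
Qed.

Section GridLaw.
Variables (R : realType) (k : nat).

Definition grid_point (a : nat) : R := a%:R / k.+1%:R.

Lemma grid_point_inj : injective grid_point.
Proof.
move=> a b /(congr1 (fun x => x * k.+1%:R)); rewrite /grid_point.
by rewrite !divfK ?pnatr_eq0// => /eqP; rewrite eqr_nat => /eqP.
Qed.

Lemma grid_point_itv (a : 'I_k.+1) : 0 <= grid_point a <= 1.
Proof.
by rewrite /grid_point divr_ge0//= ler_pdivrMr ?ltr0n// mul1r ler_nat ltnW.
Qed.

Lemma inv_card_ge0 : 0 <= (k.+1%:R : R)^-1.
Proof. by rewrite invr_ge0. Qed.

Definition grid_law : set (measurableTypeR R) -> \bar R :=
  mscale (NngNum inv_card_ge0)
    (msum (fun a : nat => \d_(grid_point a : measurableTypeR R)) k.+1).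

HB.instance Definition _ := Measure.on grid_law.

Lemma grid_lawE (A : set R) :
  grid_law A = ((k.+1%:R^-1)%:E * \sum_(a < k.+1) \d_(grid_point a) A)%E.
Proof. by []. Qed.

Lemma grid_lawT : grid_law setT = 1%E.
Proof.
rewrite grid_lawE; under eq_bigr do rewrite diracT.
by rewrite sumEFin sumr_const card_ord -EFinM mulVf// pnatr_eq0.
Qed.

HB.instance Definition _ :=
  Measure_isProbability.Build _ _ R grid_law grid_lawT.

Lemma grid_law_unit_interval : grid_law `[0, 1] = 1%E.
Proof.
rewrite -grid_lawT !grid_lawE; congr (_ * _)%E; apply: eq_bigr => a _.
by rewrite !diracE !mem_set//= in_itv /= grid_point_itv.
Qed.

Lemma grid_law_set1 (a : 'I_k.+1) : grid_law [set grid_point a] = (k.+1%:R^-1)%:E.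
Proof.
rewrite grid_lawE (bigD1 a)//= diracE mem_set// big1 ?adde0 ?mule1// => b ba.
rewrite diracE memNset//= => /grid_point_inj/val_inj/eqP.
by rewrite (negbTE ba).
Qed.

Definition grid_tuple n (z : {ffun 'I_n -> 'I_k.+1}) : n.-tuple R :=
  [tuple grid_point (z i) | i < n].

Lemma grid_tuple_inj n : injective (@grid_tuple n).
Proof.
move=> z z' zz'; apply/ffunP => i; apply/val_inj/grid_point_inj.
by have := congr1 (fun t => tnth t i) zz'; rewrite !tnth_mktuple.
Qed.

Lemma iid_grid_law_set1 n (z : {ffun 'I_n -> 'I_k.+1}) :
  iid_law grid_law n [set grid_tuple z] = (k.+1%:R^-1 ^+ n)%:E.
Proof.
rewrite iid_law_set1; last by move=> x; exact: measurable_set1.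
under eq_bigr => i _ do rewrite tnth_mktuple.
transitivity (\prod_(i < n) (k.+1%:R^-1)%:E : \bar R)%E.
  by apply: eq_bigr => i _; exact: grid_law_set1.
by rewrite prodEFin prodr_const card_ord.
Qed.

(** Each grid tuple is an atom of mass (k + 1)^(-n). The simple function that equals [F] on these
    atoms and 0 elsewhere lies below [F] on [D], and its integral is the mean. *)
Lemma mean_le_integral_iid n (D : set (n.-tuple R)) (F : n.-tuple R -> R) :
  (forall x, D x -> 0 <= F x) -> (forall z, D (grid_tuple z)) ->
  ((mean (fun z => F (grid_tuple z)))%:E <=
   \int[iid_law grid_law n]_(x in D) (F x)%:E)%E.
Proof.
move=> F0 Dz.
pose g (x : n.-tuple R) : \bar R := (\sum_(z : {ffun 'I_n -> 'I_k.+1})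
  (F (grid_tuple z))%:E * (\1_[set grid_tuple z] x)%:E)%E.
have m1 z : measurable [set @grid_tuple n z].
  by apply: measurable_set1_tuple => x; exact: measurable_set1.
have gi : (\int[iid_law grid_law n]_x g x)%E =
    (mean (fun z => F (grid_tuple z)))%:E.
  rewrite /g ge0_integral_sum//=; last 2 first.
  - move=> z; apply: measurable_funeM.
    by apply/measurable_EFinP; apply: measurable_indic; exact: m1.
  - by move=> z x _; apply: mule_ge0; rewrite lee_fin ?F0// indicE.
  rewrite /mean mulr_suml -sumEFin; apply: eq_bigr => z _.
  rewrite ge0_integralZl//; last 2 first.
  - by apply/measurable_EFinP; apply: measurable_indic; exact: m1.
  - by rewrite lee_fin F0.
  rewrite integral_indic//; last exact: m1.
  rewrite classical_sets.setIT EFinM; congr (_ * _)%E.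
  apply: etrans (iid_grid_law_set1 z) _.
  by rewrite card_ffun !card_ord natrX exprVn.
rewrite -gi; apply: le_integral_patch => [x /F0|x|x].
- by rewrite lee_fin.
- apply: sume_ge0 => z _; rewrite mule_ge0 ?lee_fin ?F0//.
- rewrite patchE /g; case: (pselect (exists z, x = grid_tuple z)) => [[z ->]|nz].
    rewrite mem_set// (bigD1 z)//= indicE mem_set// mule1 big1 ?adde0// => z' z'z.
    rewrite indicE memNset ?mule0//= => /grid_tuple_inj zz'.
    by rewrite zz' eqxx in z'z.
  rewrite big1 => [|z _]; first by case: ifP => // /set_mem /F0; rewrite lee_fin.
  by rewrite indicE memNset ?mule0//= => xz; apply: nz; exists z.
Qed.

End GridLaw.

(** * The risk of the bump graphon *)

Lemma sum_lt_pairs n : (\sum_(e : 'I_n * 'I_n | e.1 < e.2) 1 = 'C(n, 2))%N.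
Proof.
rewrite -(pair_big_dep xpredT (fun i j : 'I_n => i < j)%N (fun _ _ => 1%N)) /=.
rewrite (exchange_big_dep xpredT) //= -bin2_sum big_mkord.
apply: eq_bigr => j _.
by rewrite -(big_ord_widen n (fun=> 1%N)) ?sum1_card ?card_ord// ltnW.
Qed.

Lemma eq_derivm_on (R : comPzRingType) (E : finType) (phat : {set E} -> R)
    (P : pred E) (T : {set E}) (q q' : E -> R) :
  (forall (S : {set E}) e, phat S != 0 -> e \in S -> P e) ->
  (forall e, P e -> q e = q' e) -> derivm phat T q = derivm phat T q'.
Proof.
move=> phatP qq'; apply: eq_bigr => S _.
have [->|pS] := eqVneq (phat S) 0; first by rewrite !mul0r.
congr (_ * _); apply: eq_bigr => e /setDP[eS _]; apply: qq'; exact: phatP eS.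
Qed.

Lemma graph_pmf_ge0 (R : realType) n (Q : 'M[R]_n) a :
  (forall i j, 0 <= Q i j <= 1) -> 0 <= graph_pmf Q a.
Proof.
move=> Q01; rewrite /graph_pmf; case: ifP => // _; apply: prodr_ge0 => e _.
rewrite /bernoulli_pmf; have /andP[? ?] := Q01 e.1 e.2.
by case: ifP => // _; rewrite subr_ge0.
Qed.

Section RiskLowerBound.
Variables (R : realType) (n k D m : nat) (q0 d tau : R).
Hypotheses (n_ge2 : (2 <= n)%N) (d_ge0 : 0 <= d) (q0_ge0 : 0 <= q0)
  (q0d_le1 : q0 + d <= 1) (tau_gt0 : 0 < tau).
Hypotheses (tau_q0 : tau <= q0 * (1 - q0))
  (tau_q0d : tau <= (q0 + d) * (1 - (q0 + d))).
Hypothesis small : D.+1%:R ^+ 2 *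
  (D.+2%:R * d ^+ 2 + n%:R * (2 * d / k.+1%:R) ^+ 2) <= tau.
Local Notation lab := {ffun 'I_n -> 'I_k.+1}.
Local Notation edge := ('I_n * 'I_n)%type.
Local Notation f := (bump_graphon m q0 d k.+1%:R).
Local Notation M z := (edge_probabilities f (grid_tuple R z)).

Lemma edge_probabilities_grid (z : lab) i j :
  M z i j = if i == j then 0 else q0 + (if z i == z j then d else 0).
Proof.
by rewrite mxE; case: ifP => // _; rewrite !tnth_mktuple bump_graphon_grid// ler1n.
Qed.

Lemma edge_probabilities_edge_mean (z : lab) (e : edge) : (e.1 < e.2)%N ->
  M z e.1 e.2 = edge_mean q0 d z e.
Proof.
move=> e12; rewrite edge_probabilities_grid /edge_mean e12.
by have -> : (e.1 == e.2) = false by apply/negbTE; rewrite neq_ltn e12.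
Qed.

Lemma edge_variance_ge (z : lab) (e : edge) : (e.1 < e.2)%N ->
  tau <= M z e.1 e.2 * (1 - M z e.1 e.2).
Proof.
move=> e12; rewrite edge_probabilities_edge_mean// /edge_mean e12.
by case: ifP => // _; rewrite addr0.
Qed.

Lemma entry_risk_ge (Mhat : poly_estimator R n) (i j : 'I_n) :
  poly_estimators_le D Mhat -> (i < j)%N ->
  d ^+ 2 / k.+1%:R - d ^+ 2 * expR 1 / k.+1%:R ^+ 2 <=
  mean (fun z : lab => \sum_a graph_pmf (M z) a *
    (estimate Mhat a i j - M z i j) ^+ 2).
Proof.
move=> /(estimate_multilinear i j)[phat [phatD phatlt phatE]] ij.
(* Removing [q0] from the constant coefficient turns the target into d 1(z_i = z_j). *)
pose p (S : {set edge}) := phat S - (if S == finset.set0 then q0 else 0).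
have pD S : p S != 0 -> (#|S| <= D)%N.
  rewrite /p; case: (S =P finset.set0) => [->|_]; first by rewrite cards0.
  by rewrite subr0; exact: phatD.
have plt (S : {set edge}) e : p S != 0 -> e \in S -> (e.1 < e.2)%N.
  rewrite /p; case: (S =P finset.set0) => [->|_]; first by rewrite inE.
  by rewrite subr0; exact: phatlt.
have pE q : derivm p finset.set0 q = derivm phat finset.set0 q - q0.
  rewrite /derivm; under eq_bigr => S _ do rewrite mulrBl.
  rewrite sumrB; congr (_ - _).
  rewrite (bigD1 finset.set0)//= eqxx finset.setD0 big_set0 mulr1 big1 ?addr0//.
  by move=> S /andP[_ /negbTE ->]; rewrite mul0r.
have i_neq_j : i != j by rewrite neq_ltn ij.
apply: (le_trans (mean_squared_error_ge q0 d_ge0 pD tau_gt0 i_neq_j small)).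
apply: ler_mean => z.
set y := d * (z i == z j)%:R.
have yE : M z i j = q0 + y.
  by rewrite edge_probabilities_grid (negbTE i_neq_j) /y;
    case: ifP => _; rewrite ?mulr1 ?mulr0.
rewrite [leRHS](_ : _ = \sum_a graph_pmf (M z) a *
    (derivm p finset.set0 (fun e => (a e.1 e.2)%:R) - y) ^+ 2); last first.
  apply: eq_bigr => a _; have [aadj|/negbTE na] := boolP (is_adjacency a).
    by rewrite phatE// pE yE opprD addrA.
  by rewrite /graph_pmf na !mul0r.
have dE T : derivm p T (fun e => M z e.1 e.2) = derivm p T (edge_mean q0 d z).
  apply: (eq_derivm_on (P := fun e : edge => (e.1 < e.2)%N)) => //.
  by move=> e; exact: edge_probabilities_edge_mean.
rewrite graph_mean_derivm// dE !lerD2r; apply: ler_sum => T _; rewrite dE.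
have [->|dT] := eqVneq (derivm p T (edge_mean q0 d z)) 0.
  by rewrite expr2 mul0r !mulr0.
(* Each edge of T has variance at least [tau]. *)
rewrite ler_wpM2r ?sqr_ge0// -prodr_const; apply: ler_prod => e eT.
rewrite (ltW tau_gt0) /=; apply: edge_variance_ge.
have [S TS pS] := derivm_neq0 dT.
exact: plt pS (fintype.subsetP TS _ eT).
Qed.

Lemma risk_grid_law_ge (Mhat : poly_estimator R n) :
  poly_estimators_le D Mhat ->
  ((d ^+ 2 / k.+1%:R - d ^+ 2 * expR 1 / k.+1%:R ^+ 2)%:E <=
   risk Mhat f (grid_law k))%E.
Proof.
move=> MhatD; rewrite /risk.
set F := fun xi : n.-tuple R => \sum_a graph_pmf (edge_probabilities f xi) a *
  loss (estimate Mhat a) (edge_probabilities f xi).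
have f01 x y : 0 <= f x y <= 1.
  by apply: bump_graphon_itv => //; rewrite ler1n.
have F0 xi : 0 <= F xi.
  apply: sumr_ge0 => a _; apply: mulr_ge0.
    apply: graph_pmf_ge0 => i j; rewrite mxE; case: ifP => // _.
    by rewrite lexx ler01.
  rewrite /loss mulr_ge0 ?invr_ge0// sumr_ge0// => e _; exact: sqr_ge0.
apply: (@le_trans _ _ (mean (fun z : lab => F (grid_tuple R z)))%:E); last first.
  apply: mean_le_integral_iid => // z i; rewrite tnth_mktuple.
  exact: grid_point_itv.
rewrite lee_fin.
pose H (e : edge) (z : lab) := \sum_a graph_pmf (M z) a *
    (estimate Mhat a e.1 e.2 - M z e.1 e.2) ^+ 2.
rewrite (eq_mean (G := fun z => ('C(n, 2)%:R)^-1 *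
    \sum_(e : edge | (e.1 < e.2)%N) H e z)); last first.
  move=> z; rewrite /F /H exchange_big mulr_sumr; apply: eq_bigr => a _ /=.
  by rewrite /loss mulrCA mulr_sumr.
rewrite meanZ mean_sum [leRHS]mulrC ler_pdivlMr ?ltr0n ?bin_gt0//.
rewrite -sum_lt_pairs natr_sum mulr_sumr; apply: ler_sum => -[i j] /= ij.
by rewrite mulr1; exact: entry_risk_ge.
Qed.

End RiskLowerBound.

(** * Choice of the parameters *)

(* Used with u = kappa^gamma, so that n <= u^2 kappa^2 means
   n^(1 / (2 gamma + 2)) <= kappa. *)
Lemma amplitude_small (R : realFieldType) (n D : nat) (c kappa u tau d : R) :
  (1 <= D)%N -> 0 < u -> 1 <= u -> 0 < kappa -> n%:R <= u ^+ 2 * kappa ^+ 2 ->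
  28 * c ^+ 2 <= tau -> d = c / (u * D%:R ^+ 2) ->
  D.+1%:R ^+ 2 * (D.+2%:R * d ^+ 2 + n%:R * (2 * d / kappa) ^+ 2) <= tau.
Proof.
move=> D1 u0 u1 k0 nuk ctau dE; apply: le_trans ctau.
have D_ge1 : 1 <= D%:R :> R by rewrite ler1n.
rewrite -[D.+2%:R]natr1 -[D.+1%:R]natr1.
move: (D%:R) D_ge1 dE => {D1}D D1 dE.
have D0 : 0 < D by exact: lt_le_trans D1.
pose e := c / D ^+ 2.
have d2 : d ^+ 2 <= e ^+ 2.
  rewrite dE /e [u * _]mulrC invfM mulrA exprMn ler_piMr ?sqr_ge0//.
  by rewrite expr_le1// ?invr_ge0 ?(ltW u0)// invf_le1.
have nd : n%:R * (2 * d / kappa) ^+ 2 <= 4 * e ^+ 2.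
  have -> : n%:R * (2 * d / kappa) ^+ 2
      = n%:R / (u ^+ 2 * kappa ^+ 2) * (4 * e ^+ 2).
    by rewrite dE /e; field; rewrite !gt_eqF.
  apply: ler_piMl; first by apply: mulr_ge0 => //; exact: sqr_ge0.
  by rewrite ler_pdivrMr ?mul1r// mulr_gt0 ?exprn_gt0.
(* As D + 1 <= 2 D, D + 2 <= 3 D and 4 <= 4 D, the bound is 4 D^2 times 7 D e^2, that is 28 c^2 /
   D. *)
apply: (@le_trans _ _ ((2 * D) ^+ 2 * (3 * D * e ^+ 2 + 4 * D * e ^+ 2))).
  apply: ler_pM; rewrite ?sqr_ge0//.
  - by apply: addr_ge0; apply: mulr_ge0; rewrite ?sqr_ge0//; lra.
  - by rewrite ler_pXn2r ?nnegrE//; lra.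
  apply: lerD.
    by apply: ler_pM; rewrite ?sqr_ge0//; lra.
  by apply: (le_trans nd); rewrite ler_wpM2r ?sqr_ge0//; lra.
have -> : (2 * D) ^+ 2 * (3 * D * e ^+ 2 + 4 * D * e ^+ 2)
    = 28 * c ^+ 2 * D^-1.
  by rewrite /e; field; rewrite gt_eqF.
apply: ler_piMr; last by rewrite invf_le1.
by apply: mulr_ge0 => //; exact: sqr_ge0.
Qed.

Theorem theorem4 (R : realType) (gamma L : R)
    (hgamma : 2%:R^-1 < gamma) (hL : 0 < L) :
  exists2 c : R, 0 < c &
    forall n D : nat, (2 <= n)%N -> (1 <= D)%N ->
      ((c * n%:R `^ (- ((2 * gamma + 1) / (2 * gamma + 2))) / D%:R ^+ 4)%:E
       <= ereal_inf [set ereal_sup [set ereal_sup [set risk Mhat f P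
              | P in @unit_interval_laws R]
              | f in holder_graphons gamma L]
              | Mhat in @poly_estimators_le R n D])%E.
Proof.
have g0 : 0 < gamma by apply: lt_trans hgamma; rewrite invr_gt0.
pose m := Num.truncn gamma; pose r : R := (m.+1)`!%:R.
have r1 : 1 <= r by rewrite ler1n fact_gt0.
have r0 : 0 < r by exact: lt_le_trans r1.
(* At most L / 2, half of the budget for the norm, and at most 1 / 2, away from 1. *)
pose q0 := L / (2 + 2 * L).
have q0_gt0 : 0 < q0 by rewrite divr_gt0//; lra.
have q0L : q0 <= L / 2.
  by rewrite /q0 ler_pM2l// lef_pV2 ?posrE; lra.
have q0_half : q0 <= 1 / 2.
  by rewrite /q0 ler_pdivrMr; lra.
(* Bounds x (1 - x) from below on [q0, q0 + d], where 1 - x >= 1 / 4 since d will be small. *)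
pose tau := q0 / 4; have tau_gt0 : 0 < tau by rewrite divr_gt0.
(* The first bound fits the bump into the other half of [L]; the second makes d small and gives
   [28 * c1 ^+ 2 <= tau]. *)
pose c1 := Num.min (L / (4 * r)) (tau / 28).
have c1_gt0 : 0 < c1.
  by rewrite lt_min; apply/andP; split; apply: divr_gt0 => //; exact: mulr_gt0.
have c1L : c1 * r <= L / 4.
  have : c1 <= L / (4 * r) by rewrite ge_min lexx.
  by rewrite ler_pdivlMr ?mulr_gt0//; lra.
have c1tau : c1 <= tau / 28 by rewrite ge_min lexx orbT.
have tau1 : tau <= 1 / 8 by rewrite /tau; lra.
have c1sq : 28 * c1 ^+ 2 <= tau by rewrite expr2; nra.
(* Forces kappa >= 2 e, so that the correction d^2 e / kappa^2 takes at most half of d^2 / kappa. *)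
pose k0 := (Num.truncn (2 * expR 1 : R)).+1.
pose C1 : R := k0.+1%:R + 1.
have C1_gt0 : 0 < C1 by rewrite addr_gt0.
exists (c1 ^+ 2 / 2 / C1 `^ (2 * gamma + 1)).
  by rewrite !divr_gt0 ?exprn_gt0 ?powR_gt0.
move=> n D n2 D1.
have n_ge1 : 1 <= n%:R :> R by rewrite ler1n ltnW.
have Dr1 : 1 <= D%:R :> R by rewrite ler1n.
have Dr0 : 0 < D%:R :> R by exact: lt_le_trans Dr1.
pose nu := n%:R `^ (2 * gamma + 2)^-1 : R.
have g22 : 0 < 2 * gamma + 2 by lra.
have nu1 : 1 <= nu.
  by rewrite -[leLHS](powRr0 n%:R) ler_powR// invr_ge0 ltW.
(* An integer kappa between nu and C1 nu, hence of order n^(1 / (2 gamma + 2)). *)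
pose k := (Num.truncn nu + k0)%N; pose kappa : R := k.+1%:R.
have [nu_lo nu_hi] := andP (truncn_itv (le_trans ler01 nu1)).
have kappaE : kappa = (Num.truncn nu)%:R + 1 + k0%:R.
  by rewrite /kappa /k -addSn natrD -natr1.
have kappa_nu : nu <= kappa.
  by rewrite kappaE (le_trans (ltW nu_hi))// -natr1 lerDl.
have kappa_e : 2 * expR 1 <= kappa.
  have e0 : 0 <= 2 * expR 1 :> R by rewrite mulr_ge0// expR_ge0.
  have [_ h] := andP (truncn_itv e0).
  by rewrite kappaE (le_trans (ltW h))// lerDr addr_ge0.
have kappa_C1 : kappa <= C1 * nu.
  have k00 : 0 <= k0%:R :> R by [].
  by rewrite kappaE /C1 -natr1; nra.
have kappa_ge1 : 1 <= kappa by exact: le_trans kappa_nu.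
have kappa_gt0 : 0 < kappa by exact: lt_le_trans kappa_ge1.
pose u := kappa `^ gamma.
have u1 : 1 <= u by rewrite -[leLHS](powRr0 kappa) ler_powR// ltW.
have u0 : 0 < u by exact: lt_le_trans u1.
have uu a : kappa `^ (2 * gamma + a%:R) = u ^+ 2 * kappa ^+ a.
  rewrite powRD; last by apply/implyP => _; rewrite gt_eqF.
  by rewrite powR_mulrn ?(ltW kappa_gt0)// [2 * gamma]mulrC powRrM powR_mulrn ?powR_ge0.
have nuk : n%:R <= u ^+ 2 * kappa ^+ 2.
  rewrite -uu -[leLHS](_ : nu `^ (2 * gamma + 2) = _).
    by rewrite ge0_ler_powR ?nnegrE// ltW// (lt_le_trans ltr01).
  by rewrite /nu -powRrM mulVf ?gt_eqF// powRr1.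
pose d := c1 / (u * D%:R ^+ 2).
have d_gt0 : 0 < d by rewrite divr_gt0// mulr_gt0// exprn_gt0.
have d_c1 : d * u <= c1.
  have -> : d * u = c1 / D%:R ^+ 2 by rewrite /d; field; rewrite !gt_eqF.
  by rewrite ler_piMr ?(ltW c1_gt0)// invf_le1 ?exprn_gt0// exprn_ege1.
have d_small : d <= c1 by apply: le_trans d_c1; rewrite ler_peMr// ltW.
have small := amplitude_small D1 u0 u1 kappa_gt0 nuk c1sq (erefl d).
apply: le_ereal_inf_tmp => _ [Mhat MhatD <-].
have f_holder : holder_graphons gamma L (bump_graphon m q0 d kappa).
  apply: bump_holder_graphon => //; rewrite ?(ltW q0_gt0) ?(ltW d_gt0) ?(ltW g0)//; last by lra.
  have : d * r * u <= c1 * r by rewrite mulrAC ler_wpM2r// (le_trans ler01).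
  by rewrite -/r -/u; lra.
apply: (@le_trans _ _ (risk Mhat (bump_graphon m q0 d kappa) (grid_law k))); last first.
  apply: le_trans (ereal_sup_ubound _); last first.
    by exists (bump_graphon m q0 d kappa).
  apply: ereal_sup_ubound; exists (grid_law k) => //.
  exact: grid_law_unit_interval.
have tau_q : forall x, q0 <= x <= q0 + d -> tau <= x * (1 - x).
  move=> x /andP[x0 x1]; rewrite /tau; nra.
apply: le_trans (@risk_grid_law_ge _ n k D m q0 d tau n2 (ltW d_gt0) (ltW q0_gt0)
  _ tau_gt0 _ _ small Mhat MhatD); last 3 first.
- lra.
- by apply: tau_q; lra.
- by apply: tau_q; lra.
rewrite lee_fin -/kappa.
apply: (@le_trans _ _ (d ^+ 2 / (2 * kappa))); last first.
  rewrite -subr_ge0 [leRHS](_ : _ =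
    d ^+ 2 / (2 * kappa ^+ 2) * (kappa - 2 * expR 1)); last first.
    by field; rewrite gt_eqF.
  apply: mulr_ge0; last by rewrite subr_ge0.
  by apply: divr_ge0; [exact: sqr_ge0|apply: mulr_ge0 => //; exact: sqr_ge0].
(* The left side is kappa^(2 gamma + 1), and kappa <= C1 nu. *)
have rate : u ^+ 2 * kappa <=
    C1 `^ (2 * gamma + 1) * n%:R `^ ((2 * gamma + 1) / (2 * gamma + 2)).
  have := uu 1%N; rewrite expr1 => <-.
  rewrite [_ / _]mulrC powRrM -/nu -powRM ?(ltW C1_gt0)//; last exact: le_trans nu1.
  rewrite ge0_ler_powR ?nnegrE ?(ltW kappa_gt0)//; first by lra.
  by rewrite mulr_ge0 ?(ltW C1_gt0)// (le_trans ler01).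
rewrite powRN.
set X := C1 `^ _ in rate *; set Y := n%:R `^ _ in rate *.
have X0 : 0 < X by rewrite powR_gt0.
have Y0 : 0 < Y by rewrite powR_gt0// (lt_le_trans ltr01).
have -> : c1 ^+ 2 / 2 / X / Y / D%:R ^+ 4 = c1 ^+ 2 / (2 * D%:R ^+ 4) / (X * Y).
  by field; rewrite !gt_eqF.
have -> : d ^+ 2 / (2 * kappa) = c1 ^+ 2 / (2 * D%:R ^+ 4) / (u ^+ 2 * kappa).
  by rewrite /d; field; rewrite !gt_eqF.
apply: ler_wpM2l.
  by apply: divr_ge0; [exact: sqr_ge0|apply: mulr_ge0 => //; exact: exprn_ge0].
by rewrite lef_pV2 ?posrE ?mulr_gt0 ?exprn_gt0.
Qed.
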